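(* Fix $\epsilon\in(0,1)$. Suppose that $\mathcal{P}$ is a subset of the primes $\le x$, and $u\in[1,\log x]$ is such that $$\sum_{\substack{p\in\mathcal{P} \\ x^{1/u}<p\le x}}\frac1p>\epsilon.$$ Then there exists $t\in[x^{1/u},x]$ such that $$\frac{\Psi(t;\mathcal{P})}{t}\ \gg\ \frac{\epsilon\min\{1,\epsilon u\}}{\log u}\prod_{\substack{p\in\mathcal{E} \\ p\le t}}\left(1-\frac1p\right).$$
   Context: $\mathcal{E}=\{p\le x:\ p\text{ prime},\ p\notin\mathcal{P}\}$ is the complement of $\mathcal{P}$ among the primes up to $x$. $\Psi(t;\mathcal{P})$ denotes the number of positive integers $n\le t$ all of whose prime factors lie in $\mathcal{P}$. The notation $f\gg g$ means $f\ge c\,g$ for some absolute constant $c>0$.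
   Formalization: The claim fails as u tends to 1 for small x (x=3, P={3}, ε=1/6, where 1/log u is unbounded), so it is additionally assumed that x ≥ x_0(ε) or that x^{1/u} ≤ x/2; the implied constant stays absolute. *)

(* Defs.v *)
From HB Require Import structures.
From mathcomp Require Import all_boot all_order all_algebra.
From mathcomp Require Import all_classical all_reals all_analysis.

Set Implicit Arguments.
Unset Strict Implicit.
Unset Printing Implicit Defensive.

Import Order.TTheory GRing.Theory Num.Theory.

Local Open Scope ring_scope.

Definition primes_upto_set (R : realType) (x : R) (P : pred nat) : Prop :=
  forall p : nat, p \in P -> prime p /\ p%:R <= x.

Definition compl_primes (R : realType) (x : R) (P : pred nat) : pred nat :=
  [pred p : nat | [&& prime p, p%:R <= x & p \notin P]].

(* For t < 1 the range is empty; for n = 1, primes n = [::], so n = 1 is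
   always counted. *)
Definition Psi (R : realType) (t : R) (P : pred nat) : nat :=
  (\sum_(1 <= n < (Num.truncn t).+1 | all [in P] (primes n)) 1)%N.

Definition recip_sum (R : realType) (y x : R) (P : pred nat) : R :=
  \sum_(1 <= p < (Num.truncn x).+1 | (p \in P) && (y < p%:R)) p%:R^-1.

Definition sieve_prod (R : realType) (t : R) (Q : pred nat) : R :=
  \prod_(1 <= p < (Num.truncn t).+1 | p \in Q) (1 - p%:R^-1).

(* Non-degeneracy of the range [x^(1/u), x].  As u tends to 1 from above the
   factor 1 / log u is unbounded, and for x bounded in terms of eps the
   interval (x^(1/u), x] may still contain a prime of P: for x = 3, P = {3},
   eps = 1/6 and u near 1 no constant can work, even one depending on eps.
   It is therefore required that x be large in terms of eps, or else that
   x^(1/u) <= x/2, which holds whenever u >= 2 and u <= log x. *)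
Definition nondegenerate_range (R : realType) (x0 x u : R) : Prop :=
  x0 <= x \/ x `^ u^-1 <= x / 2.

(* Main.v *)
(* Write G(t) for the product of (1 - 1/p)^-1 over the p <= t in P, and D(t) for
   the sum of 1/n over the n <= t composed of primes of P.  By Markov's inequality
   for ln n, Chebyshev's bound gives D(t) >> G(t); for P = all primes this is
   Mertens' bound, so G(w) / G(z) << ln w / ln z for every P, and the product over
   the complement of P up to t is at most G(t) / ln t.  It is thus enough to find
   t with Psi(t) ln t >= delta t G(t), where delta ln u << eps min(1, eps u).
   If there is none, averaging Psi(t) ln t >= sum_p ln p Psi(t/p) over
   y = x^(1/u) < t <= x against dt / (t^2 ln t G(t)) gives
     sum_p (1/p) D(W/2p) / G(W) << delta ln u,   W = min(p^2, x),
   for any set of primes p > y of P.  If the p <= sqrt x carry mass >> eps, this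
   is a contradiction as D(p/2) >> G(p^2).  Otherwise G(x) << G(y), and the primes
   p <= x/z with z = max(2, x^(eps/128)) have D(x/2p) >> min(1, eps u) G(x).
   Primes in (x/z, x] carry mass < eps/4 if z > 2; if z = 2 and they carry more,
   they alone make Psi(x) >= eps x / 8. *)

Require Import Defs.
From HB Require Import structures.
From mathcomp Require Import all_boot all_order all_algebra.
From mathcomp Require Import all_classical all_reals all_analysis.
From mathcomp Require Import zify ring lra.

Set Implicit Arguments.
Unset Strict Implicit.
Unset Printing Implicit Defensive.

Import Order.TTheory GRing.Theory Num.Theory.

Local Open Scope ring_scope.

(** * Primorials and central binomial coefficients *)

Lemma prod_primes_dvdn (s : seq nat) (m : nat) :
  uniq s -> {in s, forall p, prime p && (p %| m)%N} -> (\prod_(p <- s) p %| m)%N.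
Proof.
elim: s => [|p s IHs] /=; first by rewrite big_nil dvd1n.
case/andP=> pNs us H; rewrite big_cons Gauss_dvd; last first.
  rewrite big_seq; elim/big_ind: _ => [|a b|q qs]; first exact: coprimen1.
    by move=> ca cb; rewrite coprimeMr ca.
  have /andP[pp _] := H p (mem_head _ _).
  have /andP[pq _] : prime q && (q %| m)%N by apply: H; rewrite inE qs orbT.
  rewrite prime_coprime // dvdn_prime2 //.
  by apply: contraNneq pNs => ->.
have /andP[_ ->] := H p (mem_head _ _).
by apply: IHs => // q qs; apply: H; rewrite inE qs orbT.
Qed.

Lemma prime_dvd_fact (p n : nat) : prime p -> (p %| n`!)%N -> (p <= n)%N.
Proof.
move=> pp; elim: n => [|n IHn]; first by rewrite dvdn1 => /eqP p1; rewrite p1 in pp.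
by rewrite factS Euclid_dvdM // => /orP[/dvdn_leq -> //|/IHn /leqW].
Qed.

(** Row [2m + 1] of Pascal's triangle sums to [2 * 4 ^ m] and contains this coefficient twice. *)
Lemma bin_central_le (m : nat) : ('C(m.*2.+1, m) <= 4 ^ m)%N.
Proof.
have : ('C(m.*2.+1, m) + 'C(m.*2.+1, m.+1) <= 2 ^ m.*2.+1)%N.
  rewrite -[X in (_ <= X ^ _)%N](addn1 1) expnDn.
  have i1 : (m < m.*2.+2)%N by lia.
  have i2 : (m.+1 < m.*2.+2)%N by lia.
  rewrite (bigD1 (Ordinal i1)) //= (bigD1 (Ordinal i2)) /=; last first.
    by rewrite -val_eqE /=; lia.
  by rewrite !exp1n !muln1; lia.
have -> : 'C(m.*2.+1, m.+1) = 'C(m.*2.+1, m).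
  by rewrite -bin_sub; [congr 'C(_, _); lia | lia].
rewrite expnS -mul2n expnM -[(2 ^ 2)%N]/4%N; lia.
Qed.

(** Erdős's induction. An even [n > 2] is not prime and adds no factor. For [n = 2m + 1] the primes
    up to [m + 1] give [4 ^ (m + 1)] by induction, and those in [(m + 1, 2m + 1]] all divide
    ['C(2m + 1, m) <= 4 ^ m]. *)
Lemma primorial_le (n : nat) : (\prod_(1 <= p < n.+1 | prime p) p <= 4 ^ n)%N.
Proof.
elim/ltn_ind: n => n IHn.
have [n_le2|n_gt2] := leqP n 2.
  by case: n n_le2 {IHn} => [|[|[|//]]] _; rewrite unlock.
have Hn : n = (n./2.*2 + odd n)%N by rewrite addnC odd_double_half.
case odd_n: (odd n) Hn => Hn; last first.
  rewrite big_mkcond big_nat_recr /=; last by lia.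
  have -> : prime n = false.
    apply/negP => /primeP[_ /(_ 2)]; rewrite dvdn2 odd_n => /(_ isT) /orP[]; lia.
  rewrite muln1 -big_mkcond /= -[n in (\prod_(1 <= p < n | _) p)%N]prednK; last by lia.
  apply: (leq_trans (IHn n.-1 _)); first by lia.
  by rewrite leq_exp2l //; lia.
set m := n./2 in Hn; have m_gt0 : (0 < m)%N by lia.
have -> : n = m.*2.+1 by lia.
rewrite (@big_cat_nat _ _ _ m.+2) /=; [|lia|lia].
have -> : (4 ^ m.*2.+1 = 4 ^ m.+1 * 4 ^ m)%N by rewrite -expnD; congr (_ ^ _)%N; lia.
apply: leq_mul; first by apply: IHn; lia.
apply: leq_trans (bin_central_le m).
apply: dvdn_leq; first by rewrite bin_gt0; lia.
rewrite -big_filter; apply: prod_primes_dvdn; first by rewrite filter_uniq ?iota_uniq.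
move=> p; rewrite mem_filter mem_index_iota => /and3P[pp mp pm]; rewrite pp /=.
(* The prime [p] divides [(2m + 1)!], which is the binomial times [m! (m + 1)!]; being larger than
   [m + 1], it divides neither factorial. *)
have /(_ _) := @bin_fact m.*2.+1 m; have -> : (m.*2.+1 - m = m.+1)%N by lia.
move=> /(_ ltac:(lia)) E.
have : (p %| (m.*2.+1)`!)%N by rewrite dvdn_fact //; lia.
by rewrite -E Euclid_dvdM // Euclid_dvdM // => /or3P[//| |] /(prime_dvd_fact pp); lia.
Qed.

(** * Comparison of finite sums over different index sets *)

Lemma ler_sum_uniq (R : numDomainType) (r s : seq nat) (A B : pred nat) (f g : nat -> R) :
  uniq r -> uniq s ->
  (forall i, i \in r -> A i -> [&& i \in s, B i & f i <= g i]) ->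
  (forall i, i \in s -> B i -> 0 <= g i) ->
  \sum_(i <- r | A i) f i <= \sum_(i <- s | B i) g i.
Proof.
move=> ur us AB g0; rewrite big_seq_cond [leRHS]big_seq_cond.
rewrite [leRHS](bigID [pred i | (i \in r) && A i]) /=.
apply: ler_wpDr; first by apply: sumr_ge0 => i /andP[/andP[/g0 h /h]].
rewrite -[leRHS]big_filter -[leLHS]big_filter.
have rs : perm_eq [seq i <- s | (i \in s) && B i && ((i \in r) && A i)]
    [seq i <- r | (i \in r) && A i].
  apply: uniq_perm; rewrite ?filter_uniq // => i; rewrite !mem_filter.
  case ir: (i \in r); case Ai: (A i); rewrite ?andbF //=.
  by have /and3P[-> -> _] := AB i ir Ai.
rewrite (perm_big _ rs) /=.
rewrite big_seq [leRHS]big_seq; apply: ler_sum => i.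
by rewrite mem_filter => /andP[/andP[ir Ai] _]; have /and3P[] := AB i ir Ai.
Qed.

Lemma ler_sum_nat1 (R : numDomainType) (N M : nat) (A B : pred nat) (f g : nat -> R) :
  (forall i, (0 < i <= N)%N -> A i -> [&& (i <= M)%N, B i & f i <= g i]) ->
  (forall i, (0 < i <= M)%N -> B i -> 0 <= g i) ->
  \sum_(1 <= i < N.+1 | A i) f i <= \sum_(1 <= i < M.+1 | B i) g i.
Proof.
move=> AB g0; apply: ler_sum_uniq; rewrite ?iota_uniq // => i.
  rewrite !mem_index_iota !ltnS => iN Ai.
  by have /and3P[-> -> ->] := AB i iN Ai; case/andP: iN => ->.
by rewrite mem_index_iota ltnS => /g0.
Qed.

(** * Logarithms, Chebyshev's bound, and sums of [ln p / p] over dyadic blocks *)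

Lemma ln_nat_ge0 (R : realType) (n : nat) : 0 <= ln (n%:R : R).
Proof. by case: n => [|n]; [rewrite ln0 | rewrite ln_ge0 // ler1n]. Qed.

Lemma ln2_ge (R : realType) : 2^-1 <= ln (2 : R).
Proof.
have := @le_ln1Dx R (- 2^-1) ltac:(lra).
have -> : 1 + - 2^-1 = 2^-1 :> R by lra.
by rewrite lnV ?posrE //; lra.
Qed.

Lemma ln2_le1 (R : realType) : ln (2 : R) <= 1.
Proof. by have := @le_ln1Dx R 1 ltac:(lra). Qed.

Lemma ln_prod_nat (R : realType) (s : seq nat) (A : pred nat) :
  (forall i, A i -> (0 < i)%N) ->
  ln ((\prod_(i <- s | A i) i)%N%:R : R) = \sum_(i <- s | A i) ln (i%:R).
Proof.
move=> A0; suff [] : (0 < \prod_(i <- s | A i) i)%N /\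
  ln ((\prod_(i <- s | A i) i)%N%:R : R) = \sum_(i <- s | A i) ln (i%:R) by [].
elim/big_rec2 : _ => [|i y1 y2 Ai [y0 <-]]; first by rewrite ln1; split.
rewrite muln_gt0 A0 // y0; split=> //.
by rewrite natrM lnM ?posrE ?ltr0n ?(A0 i).
Qed.

Lemma chebyshev_theta_le (R : realType) (N : nat) :
  \sum_(1 <= p < N.+1 | prime p) ln (p%:R : R) <= 2 * ln 2 * N%:R.
Proof.
rewrite -ln_prod_nat; last by move=> i /prime_gt0.
have -> : 2 * ln 2 * N%:R = ln ((4 ^ N)%N%:R : R).
  rewrite natrX lnXn //; have -> : 4%:R = 2 ^+ 2 :> R by rewrite -natrX.
  by rewrite lnXn // -[RHS]mulr_natr mulr_natl.
rewrite ler_ln ?posrE ?ltr0n ?expn_gt0 //; last first.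
  by apply: prodn_cond_gt0 => p /prime_gt0.
by rewrite ler_nat primorial_le.
Qed.

(** On the block [1 / p < 2 / x], so Chebyshev's bound for the sum of [ln p] up to [x] suffices.
    Summing [k] blocks then replaces a full Mertens estimate. *)
Lemma sum_ln_prime_dyadic (R : realType) (x : R) (N : nat) : 0 < x ->
  \sum_(1 <= p < N.+1 | [&& prime p, x / 2 < p%:R & p%:R <= x]) ln p%:R / (p%:R : R)
    <= 4 * ln 2.
Proof.
move=> x0.
apply: (@le_trans _ _ (\sum_(1 <= p < (Num.truncn x).+1 | prime p) (2 / x * ln p%:R))).
  apply: ler_sum_nat1 => p Hp; last by move=> _; rewrite mulr_ge0 ?ln_nat_ge0 ?divr_ge0 // ltW.
  case/and3P=> pp xp px; rewrite pp truncn_ge_nat ?(ltW x0) // px /=.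
  rewrite mulrC ler_wpM2r ?ln_nat_ge0 //.
  rewrite -[2 / x]invf_div lef_pV2 ?posrE ?divr_gt0 ?ltr0n ?prime_gt0 //.
  exact: ltW.
rewrite -mulr_sumr.
have H := chebyshev_theta_le R (Num.truncn x).
have H2 : (Num.truncn x)%:R <= x by rewrite truncn_le ltW.
apply: (@le_trans _ _ (2 / x * (2 * ln 2 * x))).
  rewrite ler_wpM2l ?divr_ge0 ?(ltW x0) //; apply: (le_trans H).
  by rewrite ler_wpM2l // mulr_ge0 ?ln_nat_ge0.
by rewrite le_eqVlt; apply/orP; left; apply/eqP; field; lra.
Qed.

Lemma sum_ln_prime_le (R : realType) (x : R) (N k : nat) : 0 < x ->
  \sum_(1 <= p < N.+1 | [&& prime p, x / 2 ^+ k < p%:R & p%:R <= x]) ln p%:R / (p%:R : R)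
    <= 4 * k%:R * ln 2.
Proof.
move=> x0; elim: k => [|k IHk].
  rewrite expr0 divr1 mulr0 mul0r big1 // => p /and3P[_ a b].
  by move: (lt_le_trans a b); rewrite ltxx.
rewrite (bigID (fun p : nat => x / 2 ^+ k < p%:R)) /=.
have -> : 4 * k.+1%:R * ln 2 = 4 * k%:R * ln 2 + 4 * ln 2 :> R by rewrite -natr1; ring.
apply: lerD.
  apply: le_trans IHk; apply: ler_sum_nat1 => p; last first.
    by move=> _ _; rewrite divr_ge0 ?ln_nat_ge0.
  by case/andP=> _ -> /andP[/and3P[-> _ ->] ->] /=.
have y0 : 0 < x / 2 ^+ k by rewrite divr_gt0 ?exprn_gt0.
apply: le_trans (sum_ln_prime_dyadic N y0); apply: ler_sum_nat1 => p; last first.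
  by move=> _ _; rewrite divr_ge0 ?ln_nat_ge0.
case/andP=> _ -> /andP[/and3P[-> a _] b] /=; rewrite leNgt b andbT lexx andbT.
by rewrite -mulrA -invfM -exprSr.
Qed.

(** * Reciprocal sums over smooth integers against Euler products *)

Definition upto (P : pred nat) (K : nat) : pred nat :=
  [pred p | (p \in P) && (p <= K)%N].

Definition recip_smooth (R : realType) (P : pred nat) (M : nat) : R :=
  \sum_(1 <= n < M.+1 | all [in P] (primes n)) n%:R^-1.

Definition euler_prod (R : realType) (P : pred nat) (N : nat) : R :=
  \prod_(1 <= p < N.+1 | p \in P) (1 - p%:R^-1)^-1.

Lemma upto_prime (P : pred nat) (K : nat) :
  (forall p, p \in P -> prime p) -> forall p, p \in upto P K -> prime p.
Proof. by move=> Pp p /andP[/Pp]. Qed.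

Lemma in_uptoS (P : pred nat) (K p : nat) :
  (p \in upto P K.+1) = (p \in upto P K) || ((p == K.+1) && (p \in P)).
Proof. by rewrite !inE leq_eqVlt ltnS; case: (p \in P); rewrite ?andbF ?andbT //= orbC. Qed.

Lemma smooth_mul (P : pred nat) (p n : nat) : prime p -> (0 < n)%N -> p \in P ->
  all [in P] (primes (p * n)) = all [in P] (primes n).
Proof.
move=> pp n0 pP; have p0 := prime_gt0 pp.
rewrite (@eq_all_r _ _ (p :: primes n)) /= ?pP // => q.
by rewrite primesM // primes_prime // !inE.
Qed.

Lemma smooth_sub (P Q : pred nat) (n : nat) : {subset P <= Q} ->
  all [in P] (primes n) -> all [in Q] (primes n).
Proof. by move=> PQ; apply: sub_all => p; apply: PQ. Qed.

Lemma smooth_uptoS (P : pred nat) (K n : nat) : (0 < n)%N ->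
  all [in upto P K.+1] (primes n) -> ~~ (K.+1 %| n)%N -> all [in upto P K] (primes n).
Proof.
move=> n0 /allP nS nd; apply/allP => p pn; move: (nS p pn); rewrite /= in_uptoS.
case/orP=> // /andP[/eqP pK _]; move: pn; rewrite mem_primes pK.
by case/and3P=> _ _; rewrite (negbTE nd).
Qed.

Lemma big_dvdn (V : nmodType) (p M : nat) (A : pred nat) (f : nat -> V) : (0 < p)%N ->
  \sum_(1 <= n < M.+1 | (p %| n)%N && A n) f n
    = \sum_(1 <= m < (M %/ p).+1 | A (p * m)%N) f (p * m)%N.
Proof.
move=> p0; elim: M => [|M IHM]; first by rewrite div0n !big_geq.
rewrite big_mkcond big_nat_recr //= -big_mkcond IHM divnS //.
case: ifP => [/andP[pM AM]|].
  rewrite pM add1n [RHS]big_mkcond big_nat_recr //= -big_mkcond /=.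
  have pE : (p * (M %/ p).+1 = M.+1)%N.
    have := divnK pM; rewrite divnS // pM add1n mulnC; lia.
  by rewrite pE AM.
case pM: (p %| M.+1)%N => /= AM; last by rewrite addr0.
rewrite add1n [RHS]big_mkcond big_nat_recr //= -big_mkcond /=.
have -> : (p * (M %/ p).+1 = M.+1)%N.
  have := divnK pM; rewrite divnS // pM add1n mulnC; lia.
by rewrite AM.
Qed.

Section RecipSmooth.
Variable R : realType.
Implicit Types (P : pred nat) (K M N : nat).

Local Notation D := (@recip_smooth R).
Local Notation G := (@euler_prod R).

Lemma prime_inv_bounds (p : nat) : prime p -> 0 < (p%:R^-1 : R) <= 2^-1.
Proof.
move=> pp; have p2 : (2%:R : R) <= p%:R by rewrite ler_nat prime_gt1.
rewrite invr_gt0 ltr0n prime_gt0 //=.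
by rewrite lef_pV2 // posrE ltr0n prime_gt0.
Qed.

Lemma recip_smooth_ge0 P M : 0 <= D P M.
Proof. by apply: sumr_ge0 => n _; rewrite invr_ge0. Qed.

Lemma recip_smooth_le P Q M N : {subset P <= Q} -> (M <= N)%N -> D P M <= D Q N.
Proof.
move=> PQ MN; apply: ler_sum_nat1 => n; last by rewrite invr_ge0.
by case/andP=> _ nM /(smooth_sub PQ) /= ->; rewrite lexx (leq_trans nM).
Qed.

Lemma recip_smooth_ge1 P M : (0 < M)%N -> 1 <= D P M.
Proof.
move=> M0; rewrite /recip_smooth big_ltn_cond //= invr1 lerDl.
by apply: sumr_ge0 => n _; rewrite invr_ge0.
Qed.

Lemma euler_factor_ge1 P p : (forall p, p \in P -> prime p) -> p \in P ->
  1 <= (1 - p%:R^-1)^-1 :> R.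
Proof. by move=> Pp /Pp /prime_inv_bounds /andP[a b]; rewrite invf_ge1; lra. Qed.

Lemma euler_prodS P N : G P N.+1 =
  G P N * (if N.+1 \in P then (1 - N.+1%:R^-1)^-1 else 1).
Proof. by rewrite /euler_prod big_mkcond big_nat_recr //= -big_mkcond. Qed.

Lemma euler_prod_gt0 P N : (forall p, p \in P -> prime p) -> 0 < G P N.
Proof.
move=> Pp; apply: prodr_gt0 => p /(euler_factor_ge1 Pp) H.
exact: lt_le_trans H.
Qed.

Lemma euler_prod_le P M N : (forall p, p \in P -> prime p) -> (M <= N)%N ->
  G P M <= G P N.
Proof.
move=> Pp; elim: N => [|N IHN]; first by rewrite leqn0 => /eqP->.
rewrite leq_eqVlt ltnS => /orP[/eqP->//|/IHN H].
rewrite euler_prodS; apply: (le_trans H); rewrite ler_peMr ?(ltW (euler_prod_gt0 _ Pp)) //.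
by case: ifP => // /(euler_factor_ge1 Pp).
Qed.

Lemma recip_smooth_dvd P p M : prime p -> p \in P ->
  \sum_(1 <= n < M.+1 | (p %| n)%N && all [in P] (primes n)) n%:R^-1
    = p%:R^-1 * D P (M %/ p).
Proof.
move=> pp pP; rewrite big_dvdn ?prime_gt0 // /recip_smooth mulr_sumr.
rewrite big_nat_cond [RHS]big_nat_cond; apply: eq_big => m; last first.
  by move=> _; rewrite natrM invfM.
by case: ltnP => //= m0; rewrite smooth_mul //.
Qed.

(** Integers not divisible by [p = K + 1] are [upto P K]-smooth. The multiples of [p] contribute
    [1 / p] times the sum up to [M / p], hence at most [1 / p] times the whole. *)
Lemma recip_smoothS_le P K M : (forall p, p \in P -> prime p) -> K.+1 \in P ->
  D (upto P K.+1) M * (1 - K.+1%:R^-1) <= D (upto P K) M.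
Proof.
move=> Pp KP; have pK := Pp _ KP.
rewrite mulrBr mulr1 lerBlDr {1}/recip_smooth (bigID (fun n => (K.+1 %| n)%N)) /= addrC.
apply: lerD.
  apply: ler_sum_nat1 => n; last by rewrite invr_ge0.
  case/andP=> n0 nM /andP[nS nd]; rewrite nM lexx andbT /=.
  exact: smooth_uptoS nd.
under eq_bigl do rewrite andbC.
rewrite recip_smooth_dvd // ?inE ?KP ?leqnn // mulrC ler_wpM2r ?invr_ge0 //.
by apply: recip_smooth_le => //; exact: leq_div.
Qed.

Lemma upto_notin P K : K.+1 \notin P -> upto P K.+1 =i upto P K.
Proof.
move=> KP p; rewrite in_uptoS; case: eqP => [->|]; last by rewrite orbF.
by rewrite (negbTE KP) orbF.
Qed.

Lemma recip_smooth_le_euler P K M : (forall p, p \in P -> prime p) ->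
  D (upto P K) M <= G P K.
Proof.
move=> Pp; elim: K => [|K IHK].
  rewrite /euler_prod big_geq // /recip_smooth.
  have [->|M0] := posnP M; first by rewrite big_geq.
  rewrite big_ltn_cond //= invr1 big_nat_cond big1 ?addr0 // => n /andP[/andP[n2 _]].
  move/allP => /(_ (pdiv n)); rewrite mem_primes pdiv_prime // pdiv_dvd (ltnW n2) => /(_ isT).
  by rewrite /= inE leqn0 => /andP[/Pp /prime_gt0 h /eqP e]; rewrite e in h.
rewrite euler_prodS; case: ifPn => KP; last first.
  by rewrite mulr1; apply: le_trans IHK; apply: recip_smooth_le => // p; rewrite upto_notin.
have /andP[a b] := prime_inv_bounds (Pp _ KP).
rewrite ler_pdivlMr; last by rewrite subr_gt0; apply: le_lt_trans b _; lra.
exact: le_trans (recip_smoothS_le _ Pp KP) IHK.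
Qed.

(* The factor [1 + 1 / K] makes the induction close: at a prime [p = K + 1] it
   cancels [(1 + 1 / p) * (1 - 1 / p)] exactly. *)
Lemma recip_smooth_ge_half_euler P K : (forall p, p \in P -> prime p) -> (0 < K)%N ->
  exists M, (1 + K%:R^-1) / 2 * G P K <= D (upto P K) M.
Proof.
move=> Pp; case: K => // K _; elim: K => [|K [M HM]].
  exists 1%N; have -> : G P 1 = 1.
    by rewrite euler_prodS /euler_prod big_geq //; case: ifP => [/Pp //|]; rewrite mulr1.
  by apply: le_trans (recip_smooth_ge1 _ _); rewrite // invr1; lra.
rewrite euler_prodS; case: ifPn => KP; last first.
  exists M; rewrite mulr1.
  apply: (@le_trans _ _ (D (upto P K.+1) M)); last first.
    by apply: recip_smooth_le => // p; rewrite (upto_notin KP).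
  apply: le_trans HM; rewrite ler_wpM2r ?(ltW (euler_prod_gt0 _ Pp)) //.
  by rewrite ler_wpM2r ?invr_ge0 // lerD2l lef_pV2 ?posrE ?ltr0n // ler_nat.
set p := K.+2 in KP *; exists (p * M)%N; have pp := Pp _ KP.
have /andP[a b] := prime_inv_bounds pp.
(* If [n] is composed of primes of [P] up to [K + 1], then [n] and [p * n] are distinct admissible
   integers up to [p * M]. Using only the exponents 0 and 1 of [p] gives the factor [1 + 1 / p]. *)
have step : D (upto P K.+1) M * (1 + p%:R^-1) <= D (upto P p) (p * M).
  rewrite mulrDr mulr1 [leRHS]/recip_smooth [leRHS](bigID (fun n => (p %| n)%N)) /= addrC.
  apply: lerD.
    apply: ler_sum_nat1 => n; last by rewrite invr_ge0.
    case/andP=> n0 nM nS; rewrite lexx andbT (leq_trans nM) ?leq_pmull //=.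
    apply/andP; split.
      by apply: smooth_sub nS => q; rewrite !inE => /andP[-> ?]; exact: leqW.
    apply/negP => pn; move/allP: nS => /(_ p); rewrite mem_primes pp n0 pn => /(_ isT).
    by rewrite /= inE ltnn andbF.
  under [leRHS]eq_bigl do rewrite andbC.
  rewrite recip_smooth_dvd // ?inE ?KP ?leqnn // mulrC ler_wpM2l ?(ltW a) //.
  rewrite mulKn //; apply: recip_smooth_le => // q; rewrite !inE => /andP[-> ?].
  exact: leqW.
apply: le_trans step; apply: le_trans (ler_wpM2r _ HM); last by lra.
have K0 : (0 : R) < K.+1%:R by rewrite ltr0n.
have pE : (p%:R : R) = K.+1%:R + 1 by rewrite natr1.
rewrite pE le_eqVlt; apply/orP; left; apply/eqP; field.
by rewrite !gt_eqF //; lra.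
Qed.

End RecipSmooth.

(** * Mertens-type bounds for an arbitrary set of primes *)

Lemma ln_prod_exp (R : realType) (s : seq nat) (e : nat -> nat) :
  {in s, forall i, (0 < i)%N} ->
  ln ((\prod_(i <- s) i ^ e i)%N%:R : R) = \sum_(i <- s) (e i)%:R * ln i%:R.
Proof.
elim: s => [|p s IHs] s0; first by rewrite !big_nil ln1.
have p0 : (0 < p)%N by rewrite s0 ?mem_head.
have {}s0 : {in s, forall i, (0 < i)%N} by move=> i si; rewrite s0 // inE si orbT.
rewrite !big_cons natrM lnM ?IHs //.
- by rewrite natrX lnXn ?ltr0n // mulr_natl.
- by rewrite posrE ltr0n expn_gt0 p0.
rewrite posrE ltr0n big_seq; elim/big_ind: _ => // [a b a0 b0|i /s0 i0].
  by rewrite muln_gt0 a0.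
by rewrite expn_gt0 i0.
Qed.

Lemma ln_primes (R : realType) (n : nat) : (0 < n)%N ->
  ln (n%:R : R) = \sum_(p <- primes n) (logn p n)%:R * ln p%:R.
Proof.
move=> n0; rewrite -ln_prod_exp; last first.
  by move=> p; rewrite mem_primes => /andP[/prime_gt0].
by rewrite [in LHS](prod_prime_decomp n0) prime_decompE big_map.
Qed.

Section Mertens.
Variable R : realType.
Implicit Types (P : pred nat) (K M N : nat).

Local Notation D := (@recip_smooth R).
Local Notation G := (@euler_prod R).

Lemma sum_primes_le n N (A : pred nat) (F : nat -> R) :
  (forall p, p \in primes n -> A p && (p <= N)%N) -> (forall p, A p -> 0 <= F p) ->
  \sum_(p <- primes n) F p <= \sum_(1 <= p < N.+1 | A p) F p.
Proof.
move=> nA F0; apply: ler_sum_uniq; rewrite ?primes_uniq ?iota_uniq // => p pn Ap; last exact: F0.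
have /andP[-> pN] := nA p pn; rewrite mem_index_iota ltnS pN lexx !andbT.
by move: pn; rewrite mem_primes => /andP[/prime_gt0].
Qed.

(** Only [n = p * m] contributes, and its exponent is one more than that of [m]. The sum [T] thus
    satisfies [T <= (D + T) / p], which is solved for [T]. *)
Lemma sum_logn_smooth_le P p M : prime p -> p \in P ->
  (\sum_(1 <= n < M.+1 | all [in P] (primes n)) (logn p n)%:R / n%:R) * (p%:R - 1)
    <= D P M.
Proof.
move=> pp pP; set T := \sum_(_ <= _ < _ | _) _.
have p1 : (1 : R) < p%:R by rewrite ltr1n prime_gt1.
suff H : T <= p%:R^-1 * (D P M + T).
  move: H; rewrite ler_pdivlMl; last by lra.
  by rewrite mulrBr mulr1 lerBlDr [T * _]mulrC.
rewrite {1}/T (bigID (fun n => (p %| n)%N)) /= [X in _ + X]big1 ?addr0; last first.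
  move=> n /andP[_ pn]; by rewrite lognE (negbTE pn) !andbF mul0r.
under eq_bigl do rewrite andbC.
rewrite big_dvdn ?prime_gt0 // /T /recip_smooth -big_split /= mulr_sumr.
apply: ler_sum_nat1 => m Hm; last first.
  by move=> _; rewrite !(mulr_ge0, addr_ge0, invr_ge0).
case/andP: Hm => m0 mM; rewrite smooth_mul // => ->.
have -> : (m <= M)%N by apply: leq_trans mM (leq_div _ _).
rewrite /= lognM ?(prime_gt0 pp) // (logn_prime p pp) eqxx natrD natrM invfM mulrDl.
by rewrite mul1r mulrDr [_ * (_ * _)]mulrA ![_ / m%:R]mulrC; lra.
Qed.

Lemma sum_ln_smooth_le P K M : (forall p, p \in P -> prime p) ->
  \sum_(1 <= n < M.+1 | all [in upto P K] (primes n)) ln (n%:R : R) / n%:R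
    <= (\sum_(1 <= p < K.+1 | p \in P) ln (p%:R : R) / (p%:R - 1)) * D (upto P K) M.
Proof.
move=> Pp; have Qp := upto_prime (K := K) Pp.
apply: (@le_trans _ _ (\sum_(1 <= n < M.+1 | all [in upto P K] (primes n))
   \sum_(1 <= p < K.+1 | p \in upto P K) (logn p n)%:R / n%:R * ln (p%:R : R))).
  apply: ler_sum_nat1 => n; last first.
    by move=> _ _; apply: sumr_ge0 => p _; rewrite mulr_ge0 ?ln_nat_ge0 ?divr_ge0.
  case/andP=> n0 nM nS; rewrite nM nS /= ln_primes // mulr_suml.
  under eq_bigr do rewrite mulrAC.
  apply: sum_primes_le => p; last by move=> _; rewrite !mulr_ge0 ?invr_ge0 ?ln_nat_ge0.
  by move=> pn; have /allP/(_ p pn) := nS; rewrite !inE => /andP[-> ->].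
rewrite exchange_big /= mulr_suml.
rewrite [leRHS]big_nat_cond.
rewrite [leLHS]big_nat_cond.
under eq_bigl => p do rewrite inE.
rewrite [leRHS](eq_bigl (fun p => (1 <= p < K.+1)%N && ((p \in P) && (p <= K)%N))); last first.
  by move=> p; rewrite ltnS; case: (p <= K)%N; rewrite ?andbF ?andbT.
apply: ler_sum => p /andP[_ pQ]; have pp := Qp _ pQ.
have p1 : (1 : R) < p%:R by rewrite ltr1n prime_gt1.
rewrite -mulr_suml mulrC -!mulrA ler_wpM2l ?ln_nat_ge0 // ler_pdivlMl; last by lra.
by rewrite mulrC sum_logn_smooth_le.
Qed.

(** Here [1 / (p - 1) <= 2 / p], and [k] dyadic blocks cover the range, with [2 ^ k <= K ^ 2]
    because [2 ^ (k - 1) < K]. The constant is [2 * 4 * 2]. *)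
Lemma sum_ln_pred_prime_le P K : (forall p, p \in P -> prime p) -> (1 < K)%N ->
  \sum_(1 <= p < K.+1 | p \in P) ln (p%:R : R) / (p%:R - 1) <= 16 * ln K%:R.
Proof.
move=> Pp K1; set k := up_log 2 K.
have /andP[klt kge] : (2 ^ k.-1 < K <= 2 ^ k)%N by apply: up_log_bounds.
have k0 : (0 < k)%N by rewrite up_log_gt0.
have K0 : (0 : R) < K%:R by rewrite ltr0n; lia.
have k2 : k%:R * ln 2 <= 2 * ln K%:R :> R.
  have -> : 2 * ln K%:R = ln ((K ^ 2)%N%:R : R) by rewrite natrX lnXn // mulr_natl.
  have -> : k%:R * ln 2 = ln ((2 ^ k)%N%:R : R) by rewrite natrX lnXn // mulr_natl.
  rewrite ler_ln ?posrE ?ltr0n ?expn_gt0 ?ler_nat //; last by lia.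
  by rewrite -(prednK k0) expnS -mulnn leq_mul // ltnW.
apply: (@le_trans _ _ (2 * (4 * k%:R * ln 2))); last by lra.
apply: le_trans (ler_wpM2l _ (sum_ln_prime_le K k K0)); last by lra.
rewrite mulr_sumr; apply: ler_sum_nat1 => p Hp; last first.
  by move=> _; rewrite mulr_ge0 // divr_ge0 ?ln_nat_ge0.
move=> /Pp pp; case/andP: Hp => p0 pK.
have p2 : (2 : R) <= p%:R by rewrite ler_nat prime_gt1.
rewrite pK pp ler_nat pK andbT /=; apply/andP; split.
  rewrite ltr_pdivrMr ?exprn_gt0 // -natrX -natrM ltr_nat.
  by apply: (leq_ltn_trans kge); rewrite -[X in (X < _)%N]mul1n ltn_pmul2r ?expn_gt0 ?prime_gt1.
rewrite mulrCA ler_wpM2l ?ln_nat_ge0 // ler_pdivlMr; last by lra.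
by rewrite mulrC ler_pdivrMr; lra.
Qed.

Lemma euler_prod1 P : (forall p, p \in P -> prime p) -> G P 1 = 1.
Proof.
by move=> Pp; by rewrite euler_prodS /euler_prod big_geq //; case: ifP => [/Pp //|]; rewrite mulr1.
Qed.

(* Markov's inequality for [ln n] with respect to the weights [1 / n]: at most
   half of the mass of the [K]-smooth integers lies beyond [K ^ 32]. *)
Lemma recip_smooth_pow_ge P K : (forall p, p \in P -> prime p) -> (0 < K)%N ->
  G P K <= 4 * D P (K ^ 32).
Proof.
move=> Pp; case: K => [//|[|K]] _.
  by rewrite euler_prod1 // exp1n; have := recip_smooth_ge1 R P (ltn0Sn 0); lra.
set k := K.+2; have [M HM] := @recip_smooth_ge_half_euler R P k Pp isT.
have k1 : (1 : R) < k%:R by rewrite ltr1n.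
have lnk : 0 < ln (k%:R : R) by rewrite ln_gt0.
have H1 : D (upto P k) M <= D (upto P k) (k ^ 32) +
   (\sum_(1 <= n < M.+1 | all [in upto P k] (primes n)) ln (n%:R : R) / n%:R) / (32 * ln k%:R).
  rewrite [leLHS](bigID (fun n => (n <= k ^ 32)%N)) /=; apply: lerD.
    apply: ler_sum_nat1 => n; last by rewrite invr_ge0.
    by move=> _ /andP[-> ->]; rewrite lexx.
  rewrite mulr_suml; apply: ler_sum_nat1 => n; last first.
    by move=> _ _; rewrite mulr_ge0 ?invr_ge0 ?mulr_ge0 ?ln_nat_ge0 ?divr_ge0 ?ln_nat_ge0.
  case/andP=> n0 nM /andP[-> kn]; rewrite nM /= mulrAC ler_peMl ?invr_ge0 //.
  rewrite ler_pdivlMr ?mulr_gt0 // mul1r.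
  have -> : 32 * ln k%:R = ln ((k ^ 32)%N%:R : R) by rewrite natrX lnXn ?mulr_natl // ltr0n.
  by rewrite ler_ln ?posrE ?ltr0n ?expn_gt0 // ler_nat ltnW // ltnNge.
have H2 := sum_ln_smooth_le k M Pp.
have H3 := @sum_ln_pred_prime_le P k Pp isT.
have D0 := recip_smooth_ge0 R (upto P k) M.
(* With weights [1 / n] the mean of [ln n] is at most [16 * ln k], half the threshold [32 * ln k];
   this fixes the exponent 32. *)
have H4 : (\sum_(1 <= n < M.+1 | all [in upto P k] (primes n)) ln (n%:R : R) / n%:R)
    / (32 * ln k%:R) <= D (upto P k) M / 2.
  rewrite ler_pdivrMr ?mulr_gt0 //; apply: (le_trans H2).
  have -> : D (upto P k) M / 2 * (32 * ln k%:R) = 16 * ln k%:R * D (upto P k) M by field.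
  exact: ler_wpM2r.
have H5 : D (upto P k) (k ^ 32) <= D P (k ^ 32).
  by apply: recip_smooth_le => // p; rewrite inE => /andP[].
have Gp := euler_prod_gt0 R k Pp.
have H6 : G P k / 2 <= (1 + k%:R^-1) / 2 * G P k.
  rewrite mulrC ler_wpM2r ?(ltW Gp) // ler_peMl ?invr_ge0 // lerDl invr_ge0 //.
lra.
Qed.

Lemma ln_succ_le N : ln (N.+2%:R : R) - ln N.+1%:R <= N.+1%:R^-1.
Proof.
rewrite -ln_div ?posrE ?ltr0n //; have := @le_ln1Dx R (N.+1%:R^-1) _.
have -> : 1 + N.+1%:R^-1 = N.+2%:R / N.+1%:R :> R.
  by rewrite -[N.+2%:R]natr1 mulrDl divff ?pnatr_eq0 // mul1r.
by apply; apply: (@lt_le_trans _ _ 0); [lra | rewrite invr_ge0].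
Qed.

Lemma ln_succ_ge N : (N.+2%:R : R)^-1 <= ln N.+2%:R - ln N.+1%:R.
Proof.
rewrite -[leRHS]opprB lerNr -ln_div ?posrE ?ltr0n //.
have := @le_ln1Dx R (- N.+2%:R^-1) _.
have -> : 1 + - N.+2%:R^-1 = N.+1%:R / N.+2%:R :> R.
  rewrite -[N.+2%:R]natr1; field.
  by apply: lt0r_neq0; have := ler0n R N; lra.
by apply; rewrite ltrN2 invf_lt1 ?ltr0n // ltr1n.
Qed.

Lemma recip_smooth_primeS N : D prime N.+1 = D prime N + N.+1%:R^-1.
Proof.
rewrite /recip_smooth big_mkcond big_nat_recr //= -big_mkcond /=; case: ifP => //.
case/negP; apply/allP => p; rewrite mem_primes => /andP[pp _]; exact: pp.
Qed.

Lemma recip_smooth_prime_ge N : ln (N.+1%:R : R) <= D prime N.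
Proof.
elim: N => [|N IHN]; first by rewrite ln1 recip_smooth_ge0.
by rewrite recip_smooth_primeS; have := lerD IHN (ln_succ_le N); rewrite addrC subrK.
Qed.

Lemma recip_smooth_prime_le N : D prime N.+1 <= 1 + ln (N.+1%:R : R).
Proof.
elim: N => [|N IHN].
  by rewrite recip_smooth_primeS /recip_smooth big_geq // ln1 invr1; lra.
rewrite recip_smooth_primeS; have := lerD IHN (ln_succ_ge N).
by rewrite -addrA [X in _ <= 1 + X]addrC subrK.
Qed.

(** Every [n <= N] has all its prime factors up to [N], so the product dominates the harmonic
    sum. *)
Lemma euler_prod_prime_ge N : ln (N.+1%:R : R) <= G prime N.
Proof.
apply: le_trans (recip_smooth_prime_ge N) _.
have Pp : forall p, p \in prime -> prime p by [].
apply: le_trans (recip_smooth_le_euler R N N Pp).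
apply: ler_sum_nat1 => n; last by rewrite invr_ge0.
move=> /andP[n0 nN] /allP nS; rewrite nN lexx andbT /=.
apply/allP => p pn; rewrite /= inE (nS p pn) /=.
by move: pn; rewrite mem_primes => /and3P[_ _ /dvdn_leq] /(_ n0) /leq_trans; apply.
Qed.

Lemma euler_prod_prime_le N : (0 < N)%N -> G prime N <= 136 * ln (N.+1%:R : R).
Proof.
case: N => // N _; have Pp : forall p, p \in prime -> prime p by [].
apply: le_trans (recip_smooth_pow_ge Pp _) _ => //.
have : (0 < N.+1 ^ 32)%N by rewrite expn_gt0.
case E : (N.+1 ^ 32)%N => [//|m] _.
(* The bound becomes [4 * (1 + 32 * ln)]. As the logarithm is at least [ln 2 >= 1 / 2], the term 4
   costs [8 * ln], and [128 + 8 = 136]. *)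
have H0 : D prime (N.+1 ^ 32) <= 1 + 32 * ln (N.+1%:R : R).
  have := recip_smooth_prime_le m; rewrite -E natrX lnXn ?ltr0n // -[ln _ *+ 32]mulr_natl.
  by [].
have H1 : ln (N.+1%:R : R) <= ln N.+2%:R by rewrite ler_ln ?posrE ?ltr0n ?ler_nat.
have H2 : ln (2 : R) <= ln N.+2%:R by rewrite ler_ln ?posrE ?ltr0n ?ler_nat.
move: H0 H1 H2 (ln2_ge R); rewrite -E.
move: (D _ _) (ln N.+1%:R) (ln N.+2%:R) (ln 2) => d a b c; lra.
Qed.

(** All Euler factors are at least 1, and those of [P] in [(z, w]] are among those of all primes. *)
Lemma euler_prod_prime_ratio P z w : (forall p, p \in P -> prime p) -> (z <= w)%N ->
  G P w * G prime z <= G prime w * G P z.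
Proof.
move=> Pp; have pp : forall p, p \in prime -> prime p by [].
elim: w => [|w IHw]; first by rewrite leqn0 => /eqP->; rewrite mulrC.
rewrite leq_eqVlt ltnS => /orP[/eqP->|/IHw H]; first by rewrite mulrC.
rewrite !euler_prodS mulrAC [leRHS]mulrAC.
have a0 : 0 <= G P w * G prime z by rewrite mulr_ge0 ?ltW ?euler_prod_gt0.
case: ifP => [wP|_].
  have -> : w.+1 \in prime := Pp _ wP; apply: ler_wpM2r => //.
  by apply: le_trans (euler_factor_ge1 R Pp wP).
rewrite mulr1; apply: (le_trans H); rewrite ler_peMr ?(le_trans a0 H) //.
by case: ifP => // /(euler_factor_ge1 R pp).
Qed.

Lemma euler_prod_growth P z w : (forall p, p \in P -> prime p) -> (z <= w)%N ->
  G P w * ln z.+1%:R <= 136 * ln w.+1%:R * G P z.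
Proof.
move=> Pp; case: w => [|w] zw.
  by move: zw; rewrite leqn0 => /eqP->; rewrite ln1 !(mulr0, mul0r).
apply: (@le_trans _ _ (G P w.+1 * G prime z)).
  by rewrite ler_wpM2l ?(ltW (euler_prod_gt0 _ _ _)) // euler_prod_prime_ge.
apply: (le_trans (euler_prod_prime_ratio Pp zw)).
by rewrite ler_wpM2r ?(ltW (euler_prod_gt0 _ _ _)) // euler_prod_prime_le.
Qed.

(** Let [K] be the integer part of the 32nd root of [N]. Passing from [N] to [K] costs
    [136 * 32 = 4352] in the Euler product, and [G(K) <= 4 D(K ^ 32) <= 4 D(N)]. *)
Lemma euler_prod_le_recip_smooth : exists2 C : R, 0 < C &
  forall P N, (forall p, p \in P -> prime p) -> (0 < N)%N -> G P N <= C * D P N.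
Proof.
exists 17408 => [|P N Pp N0]; first by rewrite ltr0n.
have ex : exists K, (K ^ 32 <= N)%N by exists 0%N.
have ub K : (K ^ 32 <= N)%N -> (K <= N)%N.
  by apply: leq_trans; case: K => // K; rewrite -[X in (X <= _)%N]expn1 leq_pexp2l.
case: (ex_maxnP ex ub) => K KN Kmax.
have K0 : (0 < K)%N by apply: Kmax; rewrite exp1n.
have NK : (N < K.+1 ^ 32)%N by rewrite ltnNge; apply/negP => /Kmax; rewrite ltnn.
have lnK0 : 0 < ln (K.+1%:R : R) by rewrite ln_gt0 // ltr1n.
have H1 := euler_prod_growth Pp (ub _ KN).
have H2 : ln (N.+1%:R : R) <= 32 * ln K.+1%:R.
  have -> : 32 * ln K.+1%:R = ln ((K.+1 ^ 32)%N%:R : R) by rewrite natrX lnXn ?mulr_natl // ltr0n.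
  by rewrite ler_ln ?posrE ?ltr0n ?expn_gt0 // ler_nat.
have H3 : G P N <= 4352 * G P K.
  rewrite -(ler_pM2r lnK0); apply: (le_trans H1).
  have -> : 4352 * G P K * ln K.+1%:R = 136 * (32 * ln K.+1%:R) * G P K by ring.
  by rewrite ler_wpM2r ?(ltW (euler_prod_gt0 _ _ _)) // ler_wpM2l.
have H4 := recip_smooth_pow_ge Pp K0.
have H5 : D P (K ^ 32) <= D P N by apply: recip_smooth_le.
clear -H3 H4 H5; lra.
Qed.

(** Factor by factor, [1 / (1 - t) <= 1 + 2t <= exp(2t)] for [0 < t <= 1 / 2]. *)
Lemma euler_prod_le_exp P z w : (forall p, p \in P -> prime p) ->
  G P w <= expR (2 * \sum_(1 <= p < w.+1 | (p \in P) && (z < p)%N) p%:R^-1) * G P z.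
Proof.
move=> Pp; have E N : 1 <= expR (2 * \sum_(1 <= p < N | (p \in P) && (z < p)%N) (p%:R^-1 : R)).
  by rewrite -expR0 ler_expR mulr_ge0 //; apply: sumr_ge0 => p _; rewrite invr_ge0.
elim: w => [|w IHw].
  apply: le_trans (euler_prod_le _ Pp (leq0n z)) _.
  by rewrite ler_peMl ?(ltW (euler_prod_gt0 _ _ _)).
have [wz|zw] := leqP w.+1 z.
  apply: le_trans (euler_prod_le _ Pp wz) _.
  by rewrite ler_peMl ?(ltW (euler_prod_gt0 _ _ _)).
rewrite euler_prodS [X in expR (2 * X)]big_mkcond big_nat_recr //= -big_mkcond zw andbT.
case: ifP => [wP|_]; last by rewrite mulr1 addr0.
rewrite mulrDr expRD mulrAC; apply: ler_pM => //.
- exact: ltW (euler_prod_gt0 _ _ _).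
- by apply: le_trans (euler_factor_ge1 R Pp wP).
have /andP[a b] := prime_inv_bounds R (Pp _ wP).
apply: le_trans (expR_ge1Dx _); move: a b; set t := _^-1 => a b.
rewrite -[leLHS]div1r ler_pdivrMr; last by lra.
have : 0 <= t * (1 - 2 * t) by rewrite mulr_ge0; lra.
lra.
Qed.

End Mertens.

(** * Averaging the counting function over an interval *)

Definition smooth_count (P : pred nat) (N : nat) : nat :=
  (\sum_(1 <= n < N.+1 | all [in P] (primes n)) 1)%N.

Section Averaging.
Variable R : realType.
Implicit Types (P Q : pred nat).

Local Notation D := (@recip_smooth R).
Local Notation G := (@euler_prod R).

Lemma smooth_countE P N :
  (smooth_count P N)%:R = \sum_(1 <= n < N.+1 | all [in P] (primes n)) (1 : R).
Proof. by rewrite natr_sum. Qed.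

Lemma sum_ln_dvd_le Q m N : (forall p, p \in Q -> prime p) -> (0 < m)%N ->
  \sum_(1 <= p < N.+1 | (p \in Q) && (p %| m)%N) ln (p%:R : R) <= ln (m%:R : R).
Proof.
move=> Qp m0; rewrite (ln_primes R m0).
apply: ler_sum_uniq; rewrite ?primes_uniq ?iota_uniq //= => p; last first.
  by move=> _ _; rewrite mulr_ge0 ?ln_nat_ge0.
move=> _ /andP[/Qp pp pm]; have pin : p \in primes m by rewrite mem_primes pp m0.
by rewrite pin /= ler_peMl ?ln_nat_ge0 // ler1n logn_gt0.
Qed.

(** Each smooth [m <= n] has [ln m <= ln n], while [ln m] is at least the sum of [ln p] over the [p]
    in [Q] dividing [m]. Exchanging the sums, the multiples [m = p * m'] are counted by
    [smooth_count P (n %/ p)]. *)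
Lemma smooth_count_ln_ge P Q n N : (forall p, p \in P -> prime p) -> {subset Q <= P} ->
  \sum_(1 <= p < N.+1 | p \in Q) ln (p%:R : R) * (smooth_count P (n %/ p))%:R
    <= (smooth_count P n)%:R * ln n%:R.
Proof.
move=> Pp QP; have Qp p : p \in Q -> prime p by move/QP/Pp.
rewrite smooth_countE mulr_suml.
apply: (@le_trans _ _ (\sum_(1 <= m < n.+1 | all [in P] (primes m))
  \sum_(1 <= p < N.+1 | p \in Q) (if (p %| m)%N then ln (p%:R : R) else 0))); last first.
  apply: ler_sum_nat1 => m; last by rewrite mul1r ln_nat_ge0.
  case/andP=> m0 mn -> /=; rewrite mn mul1r -big_mkcondr /=.
  apply: le_trans (sum_ln_dvd_le N Qp m0) _.
  by rewrite ler_ln ?posrE ?ltr0n ?ler_nat ?(leq_trans m0).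
rewrite exchange_big /=; apply: ler_sum => p pQ.
have pp := Qp _ pQ.
rewrite -big_mkcondr /= (eq_bigl (fun m => (p %| m)%N && all [in P] (primes m))); last first.
  by move=> m; rewrite andbC.
rewrite big_dvdn ?prime_gt0 // smooth_countE mulr_sumr.
rewrite big_nat_cond [leRHS]big_nat_cond le_eqVlt; apply/orP; left; apply/eqP.
apply: eq_big => m; last by rewrite mulr1.
by case: ltnP => //= m0; rewrite smooth_mul // QP.
Qed.

(** A smooth [m] with [2 * p * m <= W] is counted for every [n] in [(p * m, 2 * p * m]]. These
    [p * m] values have weight at least [1 / (2 * p * m) ^ 2] each, in total [1 / (4 * p * m)]. *)
Lemma sum_inv_sqr_window_ge P p W : (0 < p)%N ->
  D P (W %/ (2 * p)) / (4 * p%:R)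
    <= \sum_(p.+1 <= n < W.+1) (smooth_count P (n %/ p))%:R / n%:R ^+ 2.
Proof.
move=> p0.
apply: (@le_trans _ _ (\sum_(p.+1 <= n < W.+1) \sum_(1 <= m < W.+1 | all [in P] (primes m))
    (if (m <= n %/ p)%N then (n%:R ^+ 2)^-1 : R else 0))); last first.
  apply: ler_sum_uniq; rewrite ?iota_uniq // => n; rewrite mem_index_iota.
  move=> /andP[pn nW] _; rewrite pn nW /= smooth_countE mulr_suml -big_mkcondr /=.
  apply: ler_sum_nat1 => m; last by rewrite mul1r invr_ge0 exprn_ge0.
  by case/andP=> _ _ /andP[-> ->] /=; rewrite mul1r.
rewrite exchange_big /= mulr_suml.
apply: ler_sum_nat1 => m; last first.
  by move=> _ _; apply: sumr_ge0 => n _; case: ifP => // _; rewrite invr_ge0 exprn_ge0.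
case/andP=> m0 mW mS; rewrite mS (leq_trans mW) ?leq_div //=.
have mpW : (2 * (p * m) <= W)%N.
  by apply: leq_trans (leq_divM W (2 * p)); rewrite mulnA [(2 * p * m)%N]mulnC leq_mul2r mW orbT.
rewrite -big_mkcond /=.
apply: (@le_trans _ _ (\sum_((p * m).+1 <= n < (2 * (p * m)).+1) ((2 * (p * m))%N%:R ^+ 2)^-1 : R)).
  rewrite sumr_const_nat -mulr_natl.
  have -> : ((2 * (p * m)).+1 - (p * m).+1 = p * m)%N by lia.
  rewrite !natrM le_eqVlt; apply/orP; left; apply/eqP; field.
  by rewrite !pnatr_eq0; lia.
apply: ler_sum_uniq; rewrite ?iota_uniq // => n; rewrite !mem_index_iota.
case/andP=> n1 n2 _; have np : (p < n)%N by apply: leq_ltn_trans n1; rewrite leq_pmulr.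
rewrite np /= (leq_trans n2) //= leq_divRL // mulnC (ltnW n1) /=.
by rewrite lef_pV2 ?posrE ?exprn_gt0 ?ltr0n ?lerXn2r ?nnegrE ?ler_nat //; lia.
Qed.

(** Telescoping: [ln t <= t - 1] at the ratio of consecutive logarithms, with
    [ln n - ln (n - 1) >= 1 / n], bounds each term by a difference of [ln (ln n)]. *)
Lemma sum_inv_nln_le (a X : nat) : (1 < a)%N -> (a <= X)%N ->
  \sum_(a.+1 <= n < X.+1) (n%:R * ln n%:R)^-1 <= ln (ln X%:R) - ln (ln a%:R) :> R.
Proof.
move=> a1; elim: X => [|X IHX]; first by rewrite leqn0 => /eqP a0; rewrite a0 in a1.
rewrite leq_eqVlt => /orP[/eqP<-|]; first by rewrite big_geq // subrr.
rewrite ltnS => aX; rewrite big_nat_recr //=.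
have X1 : (1 < X)%N by apply: leq_trans aX.
have l0 : 0 < ln (X%:R : R) by rewrite ln_gt0 // ltr1n.
have l1 : 0 < ln (X.+1%:R : R) by rewrite ln_gt0 // ltr1n ltnW.
have H1 := IHX aX.
suff : (X.+1%:R * ln X.+1%:R)^-1 <= ln (ln X.+1%:R) - ln (ln X%:R) :> R.
  by move=> H2; apply: le_trans (lerD H1 H2) _; rewrite [leLHS]addrC addrA subrK.
rewrite -[leRHS]opprB lerNr -ln_div ?posrE //.
set t := ln X%:R / ln X.+1%:R.
have t0 : 0 < t by rewrite divr_gt0.
have H : ln t <= t - 1.
  have := @le_ln1Dx R (t - 1); rewrite [1 + _]addrC subrK; apply; lra.
apply: (le_trans H).
have := ln_succ_ge R X.-1; rewrite prednK; last by lia.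
rewrite invfM => H2.
have -> : t - 1 = - ((ln X.+1%:R - ln X%:R) / ln X.+1%:R).
  by rewrite mulrBl divff ?gt_eqF // opprB.
by rewrite lerN2 ler_pM2r ?invr_gt0.
Qed.

(* Average [Psi(n) ln n >= sum_p ln p * Psi(n / p)] over [n] with the weights
   [1 / (n ^ 2 * ln n * G(n))], keeping for each [p] only [p < n <= W], where
   [ln n <= 2 * ln p] and [G(n) <= G(W)]. *)
Lemma averaging P Q (a X : nat) (delta kappa : R) :
  (forall p, p \in P -> prime p) -> {subset Q <= P} ->
  (1 < a <= X)%N -> (forall p, p \in Q -> (a <= p)%N) -> 0 <= delta ->
  (forall n, (a < n <= X)%N -> (smooth_count P n)%:R * ln n%:R <= delta * n%:R * G P n) ->
  (forall p, p \in Q -> (p <= X)%N ->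
     kappa * G P (minn (p ^ 2) X) <= D P (minn (p ^ 2) X %/ (2 * p))) ->
  kappa * \sum_(1 <= p < X.+1 | p \in Q) p%:R^-1
    <= 8 * delta * (ln (ln X%:R) - ln (ln a%:R)).
Proof.
move=> Pp QP /andP[a1 aX] Qa d0 Hd Hk.
have Qp p : p \in Q -> prime p by move/QP/Pp.
have Gp n : 0 < G P n := euler_prod_gt0 R n Pp.
pose w (n : nat) : R := (n%:R ^+ 2 * ln n%:R * G P n)^-1.
have lnp n : (a < n)%N -> 0 < ln (n%:R : R).
  by move=> an; rewrite ln_gt0 // ltr1n (ltn_trans a1).
have w0 n : 0 <= w n.
  by rewrite invr_ge0 !mulr_ge0 ?exprn_ge0 ?ln_nat_ge0 ?(ltW (Gp _)).
have up : \sum_(a.+1 <= n < X.+1) w n * ((smooth_count P n)%:R * ln n%:R)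
    <= delta * (ln (ln X%:R) - ln (ln a%:R)).
  apply: le_trans (ler_wpM2l d0 (sum_inv_nln_le a1 aX)).
  rewrite mulr_sumr big_nat_cond [leRHS]big_nat_cond; apply: ler_sum => n.
  rewrite andbT ltnS => /andP[an nX].
  apply: (@le_trans _ _ (w n * (delta * n%:R * G P n))).
    by apply: ler_wpM2l => //; apply: Hd; rewrite an.
  rewrite /w le_eqVlt; apply/orP; left; apply/eqP; field.
  by rewrite !gt_eqF ?lnp ?Gp // ltr0n (leq_ltn_trans _ an).
have low : \sum_(1 <= p < X.+1 | p \in Q) kappa * p%:R^-1 / 8
    <= \sum_(a.+1 <= n < X.+1) w n * ((smooth_count P n)%:R * ln n%:R).
  apply: (@le_trans _ _ (\sum_(a.+1 <= n < X.+1) w n *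
     \sum_(1 <= p < X.+1 | p \in Q) ln (p%:R : R) * (smooth_count P (n %/ p))%:R)); last first.
    by apply: ler_sum => n _; rewrite ler_wpM2l // smooth_count_ln_ge.
  under [leRHS]eq_bigr do rewrite mulr_sumr.
  rewrite exchange_big /= big_nat_cond [leRHS]big_nat_cond.
  apply: ler_sum => p /andP[/andP[p0]]; rewrite ltnS => pX pQ.
  have pp := Qp _ pQ; set W := minn (p ^ 2) X.
  have lnp0 : 0 < ln (p%:R : R) by rewrite ln_gt0 // ltr1n prime_gt1.
  have pr0 : (0 : R) < p%:R by rewrite ltr0n.
  have := ler_wpM2l (ltW (_ : 0 < (2 * G P W)^-1)) (sum_inv_sqr_window_ge P W p0).
  rewrite invr_gt0 mulr_gt0 // => /(_ isT) Hw.
  have HkW := Hk _ pQ pX; rewrite -/W in HkW.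
  apply: (@le_trans _ _ ((2 * G P W)^-1 * (D P (W %/ (2 * p)) / (4 * p%:R)))).
    have -> : (2 * G P W)^-1 * (D P (W %/ (2 * p)) / (4 * p%:R)) =
      D P (W %/ (2 * p)) / G P W * p%:R^-1 / 8.
      by field; rewrite !gt_eqF.
    rewrite ler_wpM2r // ler_wpM2r ?invr_ge0 ?(ltW pr0) //.
    by rewrite ler_pdivlMr.
  apply: (le_trans Hw); rewrite mulr_sumr.
  apply: ler_sum_uniq; rewrite ?iota_uniq // => n; rewrite !mem_index_iota; last first.
    by move=> _ _; rewrite mulr_ge0 // mulr_ge0 // ln_nat_ge0.
  rewrite !ltnS leq_min => /and3P[pn npp nX] _.
  have an : (a < n)%N by apply: leq_ltn_trans pn; exact: Qa.
  rewrite an nX /=.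
  have n0 : (0 : R) < n%:R by rewrite ltr0n (leq_ltn_trans _ an).
  have ln2p : ln (n%:R : R) <= 2 * ln p%:R.
    have -> : 2 * ln p%:R = ln ((p ^ 2)%N%:R : R) by rewrite natrX lnXn ?mulr_natl.
    by rewrite ler_ln ?posrE ?ltr0n ?expn_gt0 ?p0 ?ler_nat // (leq_ltn_trans _ an).
  have GW : G P n <= G P W by apply: euler_prod_le => //; rewrite leq_min npp.
  suff key : (2 * G P W)^-1 * (n%:R ^+ 2)^-1 <= w n * ln p%:R.
    have := ler_wpM2r (ler0n R (smooth_count P (n %/ p))) key.
    by rewrite -!mulrA ![_^-1 * _%:R]mulrC.
  have -> : w n * ln p%:R = ln p%:R / (ln n%:R * G P n) / n%:R ^+ 2.
    by rewrite /w -mulrA invfM mulrC mulrCA mulrC.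
  rewrite ler_wpM2r ?invr_ge0 ?exprn_ge0 ?(ltW n0) //.
  rewrite ler_pdivlMr ?mulr_gt0 ?lnp // ler_pdivrMl ?mulr_gt0 //.
  rewrite [leRHS]mulrAC; apply: ler_pM; rewrite ?ln_nat_ge0 ?(ltW (Gp _)) //.
have := le_trans low up; rewrite -mulr_suml -mulr_sumr; lra.
Qed.

End Averaging.

(** * Primes near [x], the sieve product, and lower bounds for the reciprocal sums *)

Section SmoothTop.
Variable R : realType.
Implicit Types (P : pred nat) (x y z : R).

Local Notation D := (@recip_smooth R).
Local Notation G := (@euler_prod R).

(** Here [ln p >= ln x - ln z >= ln x / 2], so [1 / p] is at most [2 / ln x] times [ln p / p]. The
    range is covered by [k] dyadic blocks with [k * ln 2 <= 2 * ln z]. *)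
Lemma recip_sum_top_le P x z N : (forall p, p \in P -> prime p) -> 2 <= z -> z ^+ 2 <= x ->
  \sum_(1 <= p < N.+1 | [&& p \in P, x / z < p%:R & p%:R <= x]) (p%:R : R)^-1
    <= 16 * ln z / ln x.
Proof.
move=> Pp z2 zx; have z0 : 0 < z by lra.
have x0 : 0 < x by apply: lt_le_trans zx; rewrite exprn_gt0.
have lz : ln 2 <= ln z by rewrite ler_ln ?posrE.
have l2 := ln2_ge R.
have lzx : 2 * ln z <= ln x by rewrite mulr_natl -lnXn // ler_ln ?posrE ?exprn_gt0.
have lx0 : 0 < ln x by lra.
set k := (Num.truncn (ln z / ln 2)).+1.
have q0 : 0 <= ln z / ln 2 by rewrite divr_ge0; lra.
have kl : ln z < k%:R * ln 2.
  by rewrite -ltr_pdivrMr; [exact: truncnS_gt | lra].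
have kr : k%:R * ln 2 <= 2 * ln z.
  have : (Num.truncn (ln z / ln 2))%:R <= ln z / ln 2 by rewrite truncn_le.
  rewrite ler_pdivlMr; last by lra.
  have -> : k%:R = (Num.truncn (ln z / ln 2))%:R + 1 :> R by rewrite natr1.
  by rewrite mulrDl mul1r; lra.
have zk : z <= 2 ^+ k.
  by rewrite -ler_ln ?posrE ?exprn_gt0 // lnXn // -[ln 2 *+ k]mulr_natl ltW.
apply: (@le_trans _ _ (2 / ln x * (4 * k%:R * ln 2))); last first.
  have -> : 2 / ln x * (4 * k%:R * ln 2) = 8 * (k%:R * ln 2) / ln x by ring.
  by rewrite ler_pM2r ?invr_gt0 //; clear -kr; lra.
have c0 : 0 <= 2 / ln x by rewrite divr_ge0 // ltW.
apply: le_trans (ler_wpM2l c0 (sum_ln_prime_le N k x0)).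
rewrite mulr_sumr; apply: ler_sum_nat1 => p; last first.
  by move=> _ _; rewrite mulr_ge0 // divr_ge0 ?ln_nat_ge0.
case/andP=> p0 -> /and3P[/Pp -> px ->] /=; rewrite andbT.
apply/andP; split.
  by apply: le_lt_trans px; rewrite ler_pM2l // lef_pV2 ?posrE ?exprn_gt0.
have pr0 : (0 : R) < p%:R by rewrite ltr0n.
rewrite mulrA ler_peMl ?invr_ge0 ?(ltW pr0) // mulrAC ler_pdivlMr // mul1r.
have : ln (x / z) <= ln p%:R by rewrite ler_ln ?posrE ?divr_gt0 // ltW.
by rewrite ln_div ?posrE //; clear -lzx; lra.
Qed.

(** At primes outside [P] the two Euler factors cancel. This rewrites the sieve product of the
    theorem as a ratio of Euler products. *)
Lemma sieve_prod_complE P x n : (forall p, p \in P -> prime p) -> n%:R <= x ->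
  sieve_prod n%:R (compl_primes x P) * G prime n = G P n.
Proof.
move=> Pp nx; rewrite /sieve_prod natrK /euler_prod.
rewrite big_mkcond [X in _ * X]big_mkcond [RHS]big_mkcond -big_split /=.
apply: eq_big_nat => p; rewrite ltnS => /andP[p0 pn].
have px : p%:R <= x by apply: le_trans nx; rewrite ler_nat.
have -> : (p \in compl_primes x P) = prime p && (p \notin P) by rewrite inE px.
have -> : (p \in prime) = prime p by [].
have [pP|pNP] := boolP (p \in P); first by rewrite (Pp _ pP) mul1r.
case: ifPn => [/andP[pp _]|]; last by rewrite andbT => /negbTE ->; rewrite mulr1.
have /andP[a b] := prime_inv_bounds R pp.
by rewrite pp divff // gt_eqF //; lra.
Qed.

(** The primes of [P] in [(x / 2, x]] are themselves counted, and each has [1 / p < 2 / x]. *)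
Lemma smooth_count_top_ge P x : (forall p, p \in P -> prime p) -> 0 < x ->
  \sum_(1 <= p < (Num.truncn x).+1 | (p \in P) && (x / 2 < p%:R)) (p%:R : R)^-1
    <= 2 / x * (smooth_count P (Num.truncn x))%:R.
Proof.
move=> Pp x0; rewrite smooth_countE mulr_sumr; apply: ler_sum_nat1 => p; last first.
  by move=> _ _; rewrite mulr1 divr_ge0 // ltW.
case/andP=> p0 -> /andP[pP px] /=; rewrite primes_prime ?Pp //= pP /= mulr1.
by rewrite -[2 / x]invf_div lef_pV2 ?posrE ?divr_gt0 ?ltr0n // ltW.
Qed.

(** The quotient is [p / 2] rounded down, and [ln (p ^ 2 + 1)] is at most 4 times the logarithm of
    one more than it. So the Euler product loses only [136 * 4 = 544]. *)
Lemma recip_smooth_half_ge : exists2 C : R, 0 < C &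
  forall P p, (forall p, p \in P -> prime p) -> prime p ->
    G P (p ^ 2) <= C * D P (p ^ 2 %/ (2 * p)).
Proof.
have [C C0 HC] := euler_prod_le_recip_smooth R.
exists (544 * C) => [|P p Pp pp]; first by rewrite pmulr_rgt0 ?ltr0n.
have p1 := prime_gt1 pp; have p0 := prime_gt0 pp.
rewrite -mulnn divnMr // mulnn divn2.
have h0 : (0 < p./2)%N by lia.
have H1 := euler_prod_growth R Pp (_ : p./2 <= p ^ 2)%N.
have {}H1 := H1 ltac:(by rewrite -mulnn; nia).
have l0 : 0 < ln (p./2.+1%:R : R) by rewrite ln_gt0 // ltr1n.
have H2 : ln ((p ^ 2).+1%:R : R) <= 4 * ln p./2.+1%:R.
  have -> : 4 * ln p./2.+1%:R = ln ((p./2.+1 ^ 4)%N%:R : R).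
    by rewrite natrX lnXn ?mulr_natl // ltr0n.
  rewrite ler_ln ?posrE ?ltr0n ?expn_gt0 // ler_nat.
  have a1 : (p.+1 <= p./2.+1 ^ 2)%N by rewrite -mulnn; nia.
  rewrite -[4%N]/(2 * 2)%N expnM.
  by apply: (@leq_trans (p.+1 ^ 2)); [rewrite -!mulnn; nia | rewrite leq_exp2r].
have H3 := HC _ _ Pp h0.
have Gh := euler_prod_gt0 R p./2 Pp.
have H4 : G P (p ^ 2) <= 544 * G P p./2.
  rewrite -(ler_pM2r l0); apply: (le_trans H1).
  have -> : 544 * G P p./2 * ln p./2.+1%:R = 136 * (4 * ln p./2.+1%:R) * G P p./2 by ring.
  by rewrite ler_wpM2r ?(ltW Gh) // ler_wpM2l.
have := ler_wpM2l (ler0n R 544) H3; move: H4; clear; lra.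
Qed.

(** With [S] the integer square root of [X], passing from [X] to [S] costs [136 * 2 = 272], and
    passing from [S] to [Y] costs at most [exp(1 / 2) <= 2]. *)
Lemma euler_prod_le_of_light_mass P (X Y : nat) : (forall p, p \in P -> prime p) ->
  (0 < X)%N ->
  \sum_(1 <= p < X.+1 | [&& p \in P, Y < p & p ^ 2 <= X]%N) (p%:R : R)^-1 <= 4^-1 ->
  G P X <= 544 * G P Y.
Proof.
move=> Pp X0 mass.
have ex : exists s, (s ^ 2 <= X)%N by exists 0%N.
have ub s : (s ^ 2 <= X)%N -> (s <= X)%N by rewrite -mulnn; nia.
case: (ex_maxnP ex ub) => S SX Smax.
have S0 : (0 < S)%N by apply: Smax; rewrite exp1n.
have XS : (X < S.+1 ^ 2)%N by rewrite ltnNge; apply/negP => /Smax; rewrite ltnn.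
have l0 : 0 < ln (S.+1%:R : R) by rewrite ln_gt0 // ltr1n.
have H1 := euler_prod_growth R Pp (ub _ SX).
have H2 : ln (X.+1%:R : R) <= 2 * ln S.+1%:R.
  have -> : 2 * ln S.+1%:R = ln ((S.+1 ^ 2)%N%:R : R) by rewrite natrX lnXn ?mulr_natl // ltr0n.
  by rewrite ler_ln ?posrE ?ltr0n ?expn_gt0 // ler_nat.
have GS := euler_prod_gt0 R S Pp; have GY := euler_prod_gt0 R Y Pp.
have H3 : G P X <= 272 * G P S.
  rewrite -(ler_pM2r l0); apply: (le_trans H1).
  have -> : 272 * G P S * ln S.+1%:R = 136 * (2 * ln S.+1%:R) * G P S by ring.
  by rewrite ler_wpM2r ?(ltW GS) // ler_wpM2l.
have H4 := euler_prod_le_exp R Y S Pp.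
have H5 : expR (2 * \sum_(1 <= p < S.+1 | (p \in P) && (Y < p)%N) (p%:R : R)^-1) <= 2.
  have h : expR (- 2^-1 : R) >= 2^-1 by have := expR_ge1Dx (- 2^-1 : R); lra.
  apply: (@le_trans _ _ (expR (2^-1))); last first.
    by rewrite -[2^-1 in leLHS]opprK expRN -[leRHS]invrK lef_pV2 ?posrE ?expR_gt0.
  rewrite ler_expR; suff : \sum_(1 <= p < S.+1 | (p \in P) && (Y < p)%N) (p%:R : R)^-1 <= 4^-1.
    by lra.
  apply: le_trans mass; apply: ler_sum_nat1 => p; last by rewrite invr_ge0.
  case/andP=> p0 pS /andP[-> ->]; rewrite lexx (leq_trans pS (ub _ SX)) /= andbT.
  by apply: leq_trans SX; rewrite leq_exp2r.
have : G P S <= 2 * G P Y by apply: (le_trans H4); rewrite ler_wpM2r // ltW.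
lra.
Qed.

End SmoothTop.

(** The chain is [m G(X) << m G(Y) << G(M) << D(M)]. In the middle, if [M < Y], the Mertens ratio of
    logarithms is paid for by [m]; otherwise monotonicity and [m <= 1] suffice. *)
Lemma recip_smooth_large_ge (R : realType) : exists2 C : R, 0 < C &
  forall (P : pred nat) (X Y M : nat) (m : R), (forall p, p \in P -> prime p) ->
    (0 < X)%N -> (0 < M)%N -> 0 <= m <= 1 ->
    \sum_(1 <= p < X.+1 | [&& p \in P, Y < p & p ^ 2 <= X]%N) (p%:R : R)^-1 <= 4^-1 ->
    ((M < Y)%N -> m * ln Y.+1%:R <= 512 * ln M.+1%:R) ->
    m * euler_prod R P X <= C * recip_smooth R P M.
Proof.
have [C C0 HC] := euler_prod_le_recip_smooth R.
pose A : R := 136 * 512; have A1 : 1 <= A by rewrite /A; lra.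
have AE t : 136 * (512 * t) = A * t by rewrite mulrA.
clearbody A; have A0 : 0 < A by lra.
exists (544 * (A * C)); first by rewrite !pmulr_rgt0 ?ltr0n.
move=> P X Y M m Pp X0 M0 /andP[m0 m1] mass HM.
have GX := euler_prod_le_of_light_mass Pp X0 mass.
have GY := euler_prod_gt0 R Y Pp; have GM := euler_prod_gt0 R M Pp.
have l0 : 0 < ln (M.+1%:R : R) by rewrite ln_gt0 // ltr1n.
have mGY : m * euler_prod R P Y <= A * euler_prod R P M.
  have [YM|MY] := leqP Y M.
    have YM' := euler_prod_le R Pp YM.
    apply: (@le_trans _ _ (euler_prod R P Y)); first by rewrite ler_piMl // ltW.
    by apply: (le_trans YM'); rewrite ler_peMl // ltW.
  have g := euler_prod_growth R Pp (ltnW MY).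
  rewrite -(ler_pM2r l0) -mulrA; apply: le_trans (ler_wpM2l m0 g) _.
  have -> : m * (136 * ln Y.+1%:R * euler_prod R P M) =
    136 * (m * ln Y.+1%:R) * euler_prod R P M by ring.
  have -> : A * euler_prod R P M * ln M.+1%:R = A * ln M.+1%:R * euler_prod R P M by ring.
  rewrite -AE ler_wpM2r ?(ltW GM) //.
  by rewrite ler_wpM2l ?ler0n ?HM.
have h1 := ler_wpM2l m0 GX.
have h2 := ler_wpM2l (ltW A0) (HC _ _ Pp M0).
move: h1 h2 mGY; set d := recip_smooth R P M; set gx := euler_prod R P X.
set gy := euler_prod R P Y; set gm := euler_prod R P M; clear => h1 h2 h3.
have -> : 544 * (A * C) * d = 544 * (A * (C * d)) by ring.
have {}h1 : m * gx <= 544 * (m * gy) by apply: (le_trans h1); rewrite mulrCA.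
lra.
Qed.

(** Controls [1 / ln u] for [u] near 1 when [z = 2]. If [u < 2], the hypotheses give [eps / 128 <=
    ln 2 / ln x <= 1 - 1 / u <= ln u], while the minimum is at most [2 * eps]. If [u >= 2], then
    [ln u >= 1 / 2]. *)
Lemma min_weight_le (R : realType) (x u eps : R) :
  0 < eps < 1 -> 1 < u -> 1 <= ln x -> ln x / u <= ln x - ln 2 ->
  eps / 128 * ln x <= ln 2 -> Num.min 1 (eps * u) <= 256 * ln u.
Proof.
move=> /andP[e0 e1] u1 x1 lu lx.
have l2 := ln2_ge R; have u0 : 0 < u by lra.
have lu1 : 1 - u^-1 <= ln u.
  have := @le_ln1Dx R (u^-1 - 1); rewrite [1 + _]addrC subrK lnV ?posrE // => H.
  have ui0 : 0 < u^-1 by rewrite invr_gt0.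
  have : - ln u <= u^-1 - 1 by apply: H; lra.
  by clear; lra.
have [u2|u2] := lerP 2 u.
  have : ln 2 <= ln u by rewrite ler_ln ?posrE.
  have : Num.min 1 (eps * u) <= 1 by rewrite ge_min lexx.
  move: (Num.min _ _) => m; clear -l2; lra.
apply: (@le_trans _ _ (2 * eps)).
  have : Num.min 1 (eps * u) <= eps * u by rewrite ge_min lexx orbT.
  have : eps * u <= eps * 2 by rewrite ler_wpM2l // ltW.
  move: (Num.min _ _) => m; clear; lra.
suff : eps / 128 <= 1 - u^-1 by clear -lu1; lra.
have L0 : 0 < ln x by lra.
rewrite -(ler_pM2r L0) mulrBl mul1r [u^-1 * _]mulrC; clear -lu lx; lra.
Qed.

(** * The contradiction from three ranges of primes *)

Theorem corollary2p3 (R : realType) :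
  exists c : R, 0 < c /\
  forall eps : R, 0 < eps < 1 ->
  exists x0 : R,
  forall (x u : R) (P : pred nat),
    primes_upto_set x P ->
    1 <= u <= ln x ->
    nondegenerate_range x0 x u ->
    eps < recip_sum (x `^ u^-1) x P ->
    exists t : R, x `^ u^-1 <= t <= x /\
      c * (eps * Num.min 1 (eps * u) / ln u * sieve_prod t (compl_primes x P))
        <= (Psi t P)%:R / t.
Proof.
have [C2 C20 HC2] := recip_smooth_half_ge R.
have [C3 C30 HC3] := recip_smooth_large_ge R.
pose K := C2 + C3 + 32; have K0 : 0 < K by rewrite /K; lra.
have KC2 : C2 <= K by rewrite /K; lra.
have KC3 : C3 <= K by rewrite /K; lra.
have K32 : 32 <= K by rewrite /K; lra.
clearbody K; pose c := (64 * K)^-1.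
have c0 : 0 < c by rewrite invr_gt0 mulr_gt0.
exists c; split=> // eps /andP[e0 e1]; exists (expR (32 / eps)) => x u P PX /andP[u1 uL] nd mass.
have Pp p : p \in P -> prime p by case/PX.
have x1 : 1 < x by rewrite ltNge; apply/negP => /ln_le0; lra.
have x0 : 0 < x by lra.
have u0 : 0 < u by lra.
have L0 : 0 < ln x by lra.
have l2 := ln2_ge R; have l21 := ln2_le1 R.
set y := x `^ u^-1 in mass *.
have y0 : 0 < y by rewrite powR_gt0.
have ly : ln y = ln x / u by rewrite ln_powR mulrC.
have ly1 : 1 <= ln y by rewrite ly ler_pdivlMr // mul1r.
(* Both forms of non-degeneracy lead here. If [x] is large and [y > x / 2], all the mass lies in
   [(x / 2, x]], where it is at most [16 * ln 2 / ln x <= eps] by the choice of [x0]. *)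
have yx : y <= x / 2.
  case: nd => // xx0; rewrite leNgt; apply/negP => xy.
  have Lbig : 32 / eps <= ln x by rewrite -[32 / eps]expRK ler_ln ?posrE ?expR_gt0.
  have e32 : 32 <= ln x * eps by rewrite -ler_pdivrMr.
  have xge4 : 2 ^+ 2 <= x.
    rewrite -ler_ln ?posrE ?exprn_gt0 // lnXn //.
    have : ln x * eps <= ln x by rewrite ler_piMr // ltW.
    clear -l21 e32; lra.
  have H := recip_sum_top_le (Num.truncn x) Pp (lexx 2) xge4.
  have : recip_sum y x P <= 16 * ln 2 / ln x.
    apply: le_trans H; apply: ler_sum_nat1 => p; last by rewrite invr_ge0.
    case/andP=> p0 pX /andP[pP yp]; rewrite pX pP lexx (lt_trans xy yp) /= andbT.
    by case: (PX _ pP).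
  suff : 16 * ln 2 / ln x <= eps by clear -mass; lra.
  by rewrite ler_pdivrMr // mulrC; clear -e32 l21; lra.
have ly2 : ln x / u <= ln x - ln 2.
  by rewrite -ly -ln_div ?posrE // ler_ln ?posrE ?divr_gt0.
have u1' : 1 < u.
  rewrite lt_neqAle u1 andbT; apply/eqP => uE; move: ly2; rewrite -uE divr1.
  clear -l2; lra.
have lu0 : 0 < ln u by rewrite ln_gt0.
set m := Num.min 1 (eps * u).
have m0 : 0 < m by rewrite lt_min ltr01 mulr_gt0.
have m1 : m <= 1 by rewrite ge_min lexx.
have meu : m <= eps * u by rewrite ge_min lexx orbT.
set B := eps * m / ln u.
have B0 : 0 < B by rewrite divr_gt0 // mulr_gt0.
apply: contrapT => no.
have nt t : y <= t <= x -> (Psi t P)%:R / t < c * (B * sieve_prod t (compl_primes x P)).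
  by move=> yt; rewrite ltNge; apply/negP => h; apply: no; exists t.
set X := Num.truncn x.
have Xx : X%:R <= x by rewrite truncn_le ltW.
have xX : x < X.+1%:R by apply: truncnS_gt.
have y2 : 2 <= y.
  by have := expR_ge1Dx (ln y); rewrite lnK ?posrE //; clear -ly1; lra.
have yX : y <= X%:R.
  by move: xX; rewrite -natr1 => xX; clear -xX yx y2; lra.
have X0 : (0 < X)%N by rewrite -(ltr0n R); apply: lt_le_trans yX.
pose Q1 := [pred p : nat | (p \in P) && (y < p%:R)].
(* Averaging with [delta = c * B], where [B * ln u = eps * m]. The start [a] is the least integer
   above [y], so every [n] in [(a, X]] is an admissible [t] and every prime of [Q] is at least
   [a]. *)
have avg (Q : pred nat) kappa : {subset Q <= Q1} ->
    (forall p, p \in Q -> (p <= X)%N ->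
       kappa * euler_prod R P (minn (p ^ 2) X)
         <= recip_smooth R P (minn (p ^ 2) X %/ (2 * p))) ->
    kappa * \sum_(1 <= p < X.+1 | p \in Q) p%:R^-1 <= 8 * c * (eps * m).
  move=> QQ Hk; set a := (Num.truncn y).+1.
  have ya : y < a%:R by apply: truncnS_gt.
  have a1 : (1 < a)%N by rewrite ltnS truncn_gt0; clear -y2; lra.
  have [aX|Xa] := leqP a X; last first.
    rewrite big_nat_cond big1 ?mulr0; first by rewrite !mulr_ge0 ?(ltW c0) ?(ltW e0) ?(ltW m0).
    move=> p /andP[/andP[_ pX] /QQ /andP[_ yp]]; move: pX; rewrite ltnNge; case/negP.
    by apply: (leq_trans Xa); rewrite truncn_lt_nat // ltW.
  have cB0 : 0 <= c * B by rewrite mulr_ge0 // ltW.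
  have := averaging (a := a) Pp _ _ _ cB0 _ Hk.
  move=> /(_ _ _ _ _) H; apply: le_trans (H _ _ _ _) _.
  - by move=> p /QQ /andP[].
  - by rewrite a1 aX.
  - by move=> p /QQ /andP[_ yp]; rewrite truncn_lt_nat // ltW.
  - move=> n /andP[an nX].
    have yn : y <= n%:R by apply: ltW; apply: (lt_trans ya); rewrite ltr_nat.
    have nx : n%:R <= x by apply: le_trans Xx; rewrite ler_nat.
    have n1 : (1 < n)%N by apply: leq_trans an; apply: ltnW.
    have n0 : (0 : R) < n%:R by rewrite ltr0n ltnW.
    have ln0 : 0 < ln (n%:R : R) by rewrite ln_gt0 // ltr1n.
    have := nt n%:R; rewrite yn nx => /(_ isT); rewrite ltr_pdivrMr // /Psi natrK => h.
    have Gp := euler_prod_gt0 R n (fun p (h : p \in prime) => h).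
    (* Since [ln n] is at most the Euler product over all primes, the assumed failure at [t = n]
       becomes a bound with [G P n], as averaging requires. *)
    have lnG : ln n%:R <= euler_prod R prime n.
      by apply: le_trans (euler_prod_prime_ge R n); rewrite ler_ln ?posrE ?ltr0n ?ler_nat // ltnW.
    rewrite -(sieve_prod_complE Pp nx).
    have s0 : 0 <= sieve_prod (n%:R : R) (compl_primes x P).
      by rewrite -(pmulr_lge0 _ Gp) (sieve_prod_complE Pp nx) ltW // euler_prod_gt0.
    have h2 := ler_wpM2r (ltW ln0) (ltW h).
    apply: (le_trans h2).
    have -> : c * B * n%:R * (sieve_prod n%:R (compl_primes x P) * euler_prod R prime n)
      = c * (B * sieve_prod n%:R (compl_primes x P)) * n%:R * euler_prod R prime n by ring.
    have t0 : 0 <= c * (B * sieve_prod n%:R (compl_primes x P)).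
      by apply: mulr_ge0; [exact: ltW | apply: mulr_ge0 => //; exact: ltW].
    by rewrite ler_wpM2l // mulr_ge0.
  have -> : 8 * c * (eps * m) = 8 * (c * B) * ln u.
    by rewrite /B; field; rewrite gt_eqF.
  rewrite ler_wpM2l //; first by rewrite mulr_ge0.
  have ly0 : 0 < ln y := lt_le_trans ltr01 ly1.
  have la0 : 0 < ln (a%:R : R) by rewrite ln_gt0 // ltr1n.
  have lX0 : 0 < ln (X%:R : R).
    by apply: (lt_le_trans ly0); rewrite ler_ln ?posrE // ltr0n.
  have -> : ln u = ln (ln x) - ln (ln y).
    rewrite -ln_div ?posrE //.
    by congr ln; rewrite ly; field; rewrite !gt_eqF.
  apply: lerB; rewrite ler_ln ?posrE // ler_ln ?posrE ?ltr0n //.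
  exact: ltW.
(* The value serves twice: the primes above [x / z] carry at most [16 * theta = eps / 8], and [2 *
   eps * ln x = 256 * theta * ln x <= 256 * ln z]. *)
set theta := eps / 128.
set z := Num.max 2 (expR (theta * ln x)).
have z2 : 2 <= z by rewrite le_max lexx.
have z0 : 0 < z by lra.
have lz : theta * ln x <= ln z.
  by rewrite -[leLHS]expRK ler_ln ?posrE ?expR_gt0 // le_max lexx orbT.
pose top := [pred p : nat | (p \in P) && (x / z < p%:R)].
pose low := [pred p : nat | [&& p \in P, y < p%:R & (p ^ 2 <= X)%N]].
pose mid := [pred p : nat | [&& p \in P, y < p%:R, p%:R <= x / z & (X < p ^ 2)%N]].
have cover : recip_sum y x P <= \sum_(1 <= p < X.+1 | top p) p%:R^-1
   + (\sum_(1 <= p < X.+1 | low p) p%:R^-1 + \sum_(1 <= p < X.+1 | mid p) p%:R^-1).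
  rewrite /recip_sum (bigID (fun p : nat => x / z < p%:R)) /=; apply: lerD.
    apply: ler_sum_nat1 => p; last by rewrite invr_ge0.
    by case/andP=> _ -> /andP[/andP[-> _] ->]; rewrite lexx.
  rewrite (bigID (fun p => p ^ 2 <= X)%N) /=; apply: lerD.
    apply: ler_sum_nat1 => p; last by rewrite invr_ge0.
    by case/andP=> _ -> /andP[/andP[/andP[-> ->] _] ->]; rewrite lexx.
  apply: ler_sum_nat1 => p; last by rewrite invr_ge0.
  by case/andP=> _ -> /andP[/andP[/andP[-> ->]]]; rewrite -leNgt -ltnNge => -> ->; rewrite lexx.
have top_small : \sum_(1 <= p < X.+1 | top p) p%:R^-1 < eps / 4.
  rewrite ltNge; apply/negP => topM.
  (* For [z = 2], mass [eps / 4] on the primes above [x / 2] forces [Psi(X) >= eps * x / 8]. This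
     contradicts the failure at [t = X], where the bound is at most [256 * eps / 2048 = eps / 8]. *)
  have [zl|zg] := lerP (expR (theta * ln x)) 2.
    have zE : z = 2 by apply/max_idPl.
    have H := smooth_count_top_ge Pp x0; rewrite -/X in H.
    move: topM; rewrite /top zE => topM.
    have := nt X%:R; rewrite yX Xx => /(_ isT); rewrite /Psi natrK -/(smooth_count P X).
    have Xr0 : (0 : R) < X%:R by rewrite ltr0n.
    have /andP[s0 s1] : 0 <= sieve_prod (X%:R : R) (compl_primes x P) <= 1.
      rewrite /sieve_prod; elim/big_ind: _ => [|a b /andP[a0 a1] /andP[b0 b1]|p].
      - by rewrite ler01 lexx.
      - by rewrite mulr_ge0 // mulr_ile1.
      rewrite inE => /andP[/(prime_inv_bounds R) /andP[a b] _].
      by move: a b; move: (_^-1) => q; clear => a b; apply/andP; split; lra.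
    have tl : theta * ln x <= ln 2 by rewrite -[leLHS]expRK ler_ln ?posrE ?expR_gt0.
    have mu : m <= 256 * ln u.
      apply: (@min_weight_le _ x) => //; first by rewrite e0.
      exact: le_trans u1 uL.
    have B256 : B <= 256 * eps.
      rewrite /B ler_pdivrMr //; have := ler_wpM2l (ltW e0) mu.
      by have -> : 256 * eps * ln u = eps * (256 * ln u) by ring.
    have c2048 : c <= 2048^-1.
      by rewrite /c lef_pV2 ?posrE ?mulr_gt0 ?ltr0n //; clear -K32; lra.
    have cBs : c * (B * sieve_prod X%:R (compl_primes x P)) <= eps / 8.
      apply: (@le_trans _ _ (2048^-1 * (256 * eps))); last by clear; lra.
      apply: ler_pM => //; [exact: ltW | by rewrite mulr_ge0 // ltW |].
      by apply: le_trans B256; rewrite ler_piMr // ltW.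
    rewrite ltNge => /negP; apply; apply: (le_trans cBs).
    rewrite ler_pdivlMr //; apply: (@le_trans _ _ (eps / 8 * x)).
      by rewrite ler_wpM2l // divr_ge0 // ltW.
    have := ler_wpM2r (ltW x0) (le_trans topM H); set n := (smooth_count P X)%:R.
    have -> : 2 / x * n * x = 2 * n by field; rewrite gt_eqF.
    by clear; lra.
  have zE : z = expR (theta * ln x) by apply/max_idPr; exact: ltW.
  have lzE : ln z = theta * ln x by rewrite zE expRK.
  have zx : z ^+ 2 <= x.
    rewrite -ler_ln ?posrE ?exprn_gt0 // lnXn // lzE -[leLHS]mulr_natl mulrA.
    by rewrite ler_piMl // ?ltW // /theta; clear -e1; lra.
  have H := recip_sum_top_le X Pp z2 zx; rewrite lzE mulrA mulfK ?gt_eqF // in H.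
  have : \sum_(1 <= p < X.+1 | top p) p%:R^-1 <= 16 * theta.
    apply: le_trans H; apply: ler_sum_nat1 => p; last by rewrite invr_ge0.
    case/andP=> p0 pX /andP[pP px]; rewrite pX /= pP px lexx /= andbT.
    by case: (PX _ pP).
  by move=> /(le_trans topM); rewrite /theta; clear -e0; lra.
have em0 : 0 < eps * m by rewrite mulr_gt0.
have cK : 8 * c * (eps * m) = (8 * K)^-1 * (eps * m).
  by rewrite /c; field; rewrite gt_eqF.
have low_small : \sum_(1 <= p < X.+1 | low p) p%:R^-1 < eps / 4.
  rewrite ltNge; apply/negP => lowM.
  have lowQ : {subset low <= Q1} by move=> p /and3P[pP yp _]; rewrite inE pP.
  (* Here [W = p ^ 2] and [kappa = 1 / C2]; with [8 * c = 1 / (8 * K)] and [C2 <= K] the mass is at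
     most [eps / 8]. *)
  have : C2^-1 * \sum_(1 <= p < X.+1 | low p) p%:R^-1 <= 8 * c * (eps * m).
    apply: (avg low _ lowQ) => p /and3P[pP yp pX] _.
    by rewrite (minn_idPl pX) ler_pdivrMl // HC2 // Pp.
  rewrite cK ler_pdivrMl // mulrA => H.
  have C2K : C2 * (8 * K)^-1 <= 8^-1.
    by rewrite ler_pdivrMr ?mulr_gt0 // mulKf // pnatr_eq0.
  have H2 : C2 * (8 * K)^-1 * (eps * m) <= 8^-1 * eps.
    apply: ler_pM => //; first by rewrite mulr_ge0 ?invr_ge0 ?mulr_ge0 // ltW.
      exact: ltW.
    by rewrite ler_piMr // ltW.
  have := le_trans (le_trans lowM H) H2; clear -e0; lra.
have midM : eps / 2 <= \sum_(1 <= p < X.+1 | mid p) p%:R^-1.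
  move: mass cover top_small low_small.
  move: (recip_sum _ _ _) (\sum_(_ <= _ < _ | top _) _) (\sum_(_ <= _ < _ | low _) _).
  move=> a b d; move: (\sum_(_ <= _ < _ | _) _) => f; clear; lra.
have midQ : {subset mid <= Q1} by move=> p /and4P[pP yp _ _]; rewrite inE pP.
set Y := Num.truncn y.
have yY p : (Y < p)%N = (y < p%:R) by rewrite truncn_lt_nat // ltW.
have light : \sum_(1 <= p < X.+1 | [&& p \in P, Y < p & p ^ 2 <= X]%N) (p%:R : R)^-1 <= 4^-1.
  apply: (@le_trans _ _ (eps / 4)); last by clear -e1; lra.
  apply: le_trans (ltW low_small); apply: ler_sum_nat1 => p; last by rewrite invr_ge0.
  by case/andP=> _ -> /and3P[pP]; rewrite yY /= => yp pX; rewrite pP yp pX lexx.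
(* From [y >= 2]: [Y + 1 <= y + 1 <= 2 * y <= y ^ 2]. *)
have lnY : ln (Y.+1%:R : R) <= 2 * (ln x / u).
  rewrite -ly [leRHS]mulr_natl -lnXn // ler_ln ?posrE ?exprn_gt0 ?ltr0n // -natr1.
  have : Y%:R <= y by rewrite truncn_le ltW.
  have : 2 * y <= y ^+ 2 by rewrite expr2 ler_wpM2r // ltW.
  clear -y2; lra.
(* Now [W = X] and [kappa = m / C3]. The smallness of [low] supplies the light-mass hypothesis, and
   [p <= x / z] makes [M = X %/ (2 * p)] large enough. *)
have : m / C3 * \sum_(1 <= p < X.+1 | mid p) p%:R^-1 <= 8 * c * (eps * m).
  apply: (avg mid _ midQ) => p /and4P[pP yp pz pX] pleX.
  have -> : minn (p ^ 2) X = X by apply/minn_idPr; exact: ltnW.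
  have p0 : (0 < p)%N := prime_gt0 (Pp _ pP).
  have pr0 : (0 : R) < p%:R by rewrite ltr0n.
  have pzx : p%:R * z <= x by rewrite -ler_pdivlMr.
  set M := (X %/ (2 * p))%N.
  have M0 : (0 < M)%N.
    rewrite divn_gt0 ?muln_gt0 // truncn_ge_nat ?(ltW x0) // natrM mulrC.
    by apply: le_trans pzx; rewrite ler_pM2l.
  (* Integer division gives [X + 1 <= 2 * p * (M + 1)], while [p * z <= x < X + 1]. *)
  have zM : z <= 2 * M.+1%:R.
    rewrite -(ler_pM2l pr0); apply: (le_trans pzx); apply: (le_trans (ltW xX)).
    rewrite mulrA [p%:R * 2]mulrC -!natrM ler_nat mulnC.
    by rewrite -ltn_divLR ?muln_gt0.
  have lzM : ln z <= 2 * ln (M.+1%:R : R).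
    have : ln z <= ln (2 * M.+1%:R) by rewrite ler_ln ?posrE ?mulr_gt0 ?ltr0n.
    rewrite lnM ?posrE ?ltr0n //.
    have : ln 2 <= ln (M.+1%:R : R) by rewrite ler_ln ?posrE ?ltr0n // ler_nat.
    by move: (ln M.+1%:R) => t; clear; lra.
  rewrite mulrAC ler_pdivrMr // [leRHS]mulrC.
  apply: (HC3 P X Y M m) => //; first by rewrite m1 ltW.
  move=> _; apply: (@le_trans _ _ (eps * u * (2 * (ln x / u)))).
    by apply: ler_pM => //; [exact: ltW | exact: ln_nat_ge0].
  have -> : eps * u * (2 * (ln x / u)) = 256 * (theta * ln x).
    by rewrite /theta; field; rewrite gt_eqF.
  by move: (le_trans lz lzM); move: (_ * _) (ln M.+1%:R) => s t; clear; lra.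
rewrite cK => H.
(* As [mid] carries at least [eps / 2] and [C3 <= K], the positive quantity [eps * m / C3] would
   satisfy [1 / 2 <= 1 / 8] after division. *)
have h1 : m / C3 * (eps / 2) <= (8 * K)^-1 * (eps * m).
  by apply: le_trans H; rewrite ler_wpM2l // divr_ge0 // ltW.
have h2 : (8 * K)^-1 * (eps * m) <= (8 * C3)^-1 * (eps * m).
  by rewrite ler_pM2r // lef_pV2 ?posrE ?mulr_gt0 // ler_pM2l.
have := le_trans h1 h2.
have -> : m / C3 * (eps / 2) = 2^-1 * (eps * m / C3) by field; rewrite gt_eqF.
have -> : (8 * C3)^-1 * (eps * m) = 8^-1 * (eps * m / C3) by field; rewrite gt_eqF.
have : 0 < eps * m / C3 by rewrite divr_gt0.
by move: (_ / C3) => t; clear; lra.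
Qed.
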